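(* Let $\Sigma_1,\Sigma_2$ be systems as in the context with $\Psi_1=\Psi_2$, and let $\mathcal R=\ker([R_1\ \ -R_2])\subseteq\mathbb R^{n_1}\times\mathbb R^{n_2}$, with $R_i\in\mathbb R^{r\times n_i}$, be a total relation satisfying $(h_0)$ $\mathrm{diag}(A_1,A_2)\,\mathcal R\subseteq\mathcal R$. Then $\mathcal R$ is a stochastic bisimulation relation between $\Sigma_1$ and $\Sigma_2$ if and only if: $(h_1)$ $R_1B_1=R_2B_2$; $(h_2)$ $R_1G_1\mu_1=R_2G_2\mu_2$; $(h_3)$ $R_1G_1G_1^TR_1^T=R_2G_2G_2^TR_2^T$; $(h_4)$ $\mathcal R\subseteq\ker([C_1\ \ -C_2])$; $(h_5)$ $\mathrm{im}(\mathcal{R}each(A_i,G_i))\cap\ker(R_i)=\{0\}$ for $i=1,2$.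
   Context: For $i=1,2$, $\Sigma_i$ is the system $x_i(t+1)=A_ix_i(t)+B_iu(t)+G_iw_i(t)$, $y_i(t)=C_ix_i(t)+\nu_i(t)$, $t\in\mathbb{N}$, with $x_i\in\mathbb{R}^{n_i}$, $u\in\mathbb{R}^m$, $w_i\in\mathbb{R}^{l_i}$, $y_i,\nu_i\in\mathbb{R}^p$, where $(w_i(t))_t$ is i.i.d. with $w_i(t)\sim\mathcal N(\mu_i,I_{l_i})$, $(\nu_i(t))_t$ is i.i.d. with $\nu_i(t)\sim\mathcal N(0,\Psi_i)$, and the two sequences are mutually independent. For a deterministic initial state $x_i^0$ and deterministic input $\mathbf u:\mathbb N\to\mathbb R^m$, $\mathbf x_i|_{x_i^0,\mathbf u}(t)=A_i^tx_i^0+\sum_{\tau=0}^{t-1}A_i^{t-1-\tau}(B_iu(\tau)+G_iw_i(\tau))$, $\mathbf y_i|_{x_i^0,\mathbf u}(t)=C_i\mathbf x_i|_{x_i^0,\mathbf u}(t)+\nu_i(t)$; $\mathbf P(\cdot\mid x_i^0)$ is probability for the process started at $x_i^0$. Processes are stochastically equivalent ($\sim$) if all finite-dimensional joint distributions coincide. $\mathrm{supp}(v)=\{z:\mathbf P(v\in B_\rho(z))>0\ \forall\rho>0\}$. For a relation $\mathcal R$: $\mathcal R(X_1)=\{x_2:\exists x_1\in X_1,(x_1,x_2)\in\mathcal R\}$, $\mathcal R^{-1}(X_2)=\{x_1:\exists x_2\in X_2,(x_1,x_2)\in\mathcal R\}$; total means $\mathcal R(\mathbb R^{n_1})=\mathbb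 R^{n_2}$ and $\mathcal R^{-1}(\mathbb R^{n_2})=\mathbb R^{n_1}$. A subspace $\mathcal R$ is a stochastic bisimulation relation between $\Sigma_1,\Sigma_2$ if for every $(x_1^0,x_2^0)\in\mathcal R$, every input $\mathbf u$ and every $t\in\mathbb N$: (i) for every measurable $X_1\subseteq\mathcal R^{-1}(\mathbb R^{n_2})$, $\mathbf P(\mathbf x_1|_{x_1^0,\mathbf u}(t)\in X_1\mid x_1^0)=\mathbf P(\mathbf x_2|_{x_2^0,\mathbf u}(t)\in\mathcal R(X_1\cap\mathrm{supp}(\mathbf x_1|_{x_1^0,\mathbf u}(t)))\mid x_2^0)$; (ii) for every measurable $X_2\subseteq\mathcal R(\mathbb R^{n_1})$, $\mathbf P(\mathbf x_2|_{x_2^0,\mathbf u}(t)\in X_2\mid x_2^0)=\mathbf P(\mathbf x_1|_{x_1^0,\mathbf u}(t)\in\mathcal R^{-1}(X_2\cap\mathrm{supp}(\mathbf x_2|_{x_2^0,\mathbf u}(t)))\mid x_1^0)$; (iii) $\mathbf y_1|_{x_1^0,\mathbf u}\sim\mathbf y_2|_{x_2^0,\mathbf u}$. $\mathcal{R}each(A_i,G_i)=[G_i\ A_iG_i\ \cdots\ A_i^{n_i-1}G_i]$. *)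

(* Defs.v *)
From HB Require Import structures.
From mathcomp Require Import all_boot all_order all_algebra.
From mathcomp Require Import all_classical all_reals all_analysis.
Set Implicit Arguments. Unset Strict Implicit. Unset Printing Implicit Defensive.
Import Order.TTheory GRing.Theory Num.Theory.
Import numFieldTopology.Exports.
Local Open Scope classical_set_scope.
Local Open Scope ring_scope.

Definition Borel (T : topologicalType) : set (set T) :=
  <<s [set U : set T | open U] >>.

Definition gauss_law {R : realType} (m v : R) : set R -> \bar R :=
  fun B => if v == 0 then (\d_m : set R -> \bar R) B
           else normal_prob m (Num.sqrt v) B.

(* X : Omega -> R^k is a Gaussian vector N(mean, cov): cov is a covariance
   matrix (symmetric positive semidefinite) and every linear functional a^T X
   is N(a^T mean, a^T cov a)  (standard definition of multivariate normal). *)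
Definition is_gaussian {R : realType} {d} {Omega : measurableType d}
  (P : probability Omega R) (k : nat) (X : Omega -> 'cV[R]_k)
  (mean : 'cV[R]_k) (cov : 'M[R]_k) : Prop :=
  cov^T = cov /\ (forall a : 'cV[R]_k, 0 <= (a^T *m cov *m a) ord0 ord0) /\
  forall (a : 'cV[R]_k) (B : set R), measurable B ->
    P [set om | B ((a^T *m X om) ord0 ord0)] =
    gauss_law ((a^T *m mean) ord0 ord0) ((a^T *m cov *m a) ord0 ord0) B.

Definition random_vec {R : realType} {d} {Omega : measurableType d}
  (k : nat) (X : Omega -> 'cV[R]_k) : Prop :=
  forall A : set 'cV[R]_k, Borel A -> measurable (X @^-1` A).

Definition indep_family {R : realType} {d} {Omega : measurableType d}
  (P : probability Omega R) (l p : nat)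
  (w : nat -> Omega -> 'cV[R]_l) (nu : nat -> Omega -> 'cV[R]_p) : Prop :=
  forall (I J : seq nat) (A : nat -> set 'cV[R]_l) (B : nat -> set 'cV[R]_p),
    uniq I -> uniq J -> (forall t, Borel (A t)) -> (forall s, Borel (B s)) ->
    P [set om | (forall t, t \in I -> A t (w t om)) /\
                (forall s, s \in J -> B s (nu s om))] =
    (\big[*%E/1%E]_(t <- I) P [set om | A t (w t om)] *
     \big[*%E/1%E]_(s <- J) P [set om | B s (nu s om)])%E.

Definition noise_model {R : realType} {d} {Omega : measurableType d}
  (P : probability Omega R) (l p : nat) (mu : 'cV[R]_l) (Psi : 'M[R]_p)
  (w : nat -> Omega -> 'cV[R]_l) (nu : nat -> Omega -> 'cV[R]_p) : Prop :=
  (forall t, random_vec (w t)) /\ (forall t, random_vec (nu t)) /\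
  (forall t, is_gaussian P (w t) mu 1%:M) /\
  (forall t, is_gaussian P (nu t) 0 Psi) /\
  indep_family P w nu.

Definition state_proc {R : realType} {Omega : Type} {n m l : nat}
  (A : 'M[R]_n) (B : 'M[R]_(n, m)) (G : 'M[R]_(n, l))
  (w : nat -> Omega -> 'cV[R]_l) (x0 : 'cV[R]_n) (u : nat -> 'cV[R]_m)
  (t : nat) : Omega -> 'cV[R]_n :=
  fun om => A ^+ t *m x0 +
    \sum_(tau < t) A ^+ (t - 1 - tau) *m (B *m u tau + G *m w tau om).

Definition output_proc {R : realType} {Omega : Type} {n m l p : nat}
  (A : 'M[R]_n) (B : 'M[R]_(n, m)) (G : 'M[R]_(n, l)) (C : 'M[R]_(p, n))
  (w : nat -> Omega -> 'cV[R]_l) (nu : nat -> Omega -> 'cV[R]_p)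
  (x0 : 'cV[R]_n) (u : nat -> 'cV[R]_m) (t : nat) : Omega -> 'cV[R]_p :=
  fun om => C *m state_proc A B G w x0 u t om + nu t om.

Definition joint {R : realType} {Omega : Type} {p : nat}
  (y : nat -> Omega -> 'cV[R]_p) (k : nat) (ts : 'I_k -> nat) :
  Omega -> 'M[R]_(p, k) := fun om => \matrix_(i, j) y (ts j) om i ord0.

Definition stoch_equiv {R : realType} {d1 d2} {Om1 : measurableType d1}
  {Om2 : measurableType d2} (P1 : probability Om1 R) (P2 : probability Om2 R)
  {p : nat} (y1 : nat -> Om1 -> 'cV[R]_p) (y2 : nat -> Om2 -> 'cV[R]_p) :=
  forall (k : nat) (ts : 'I_k -> nat) (S : set 'M[R]_(p, k)), Borel S ->
    P1 [set om | S (joint y1 ts om)] = P2 [set om | S (joint y2 ts om)].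

Definition supp {R : realType} {d} {Omega : measurableType d}
  (P : probability Omega R) {k : nat} (X : Omega -> 'cV[R]_k) : set 'cV[R]_k :=
  [set z | forall rho : R, 0 < rho -> (0 < P [set om | ball z rho (X om)])%E].

Definition rel_img {T1 T2 : Type} (Rel : set (T1 * T2)) (X1 : set T1) : set T2 :=
  [set x2 | exists2 x1, X1 x1 & Rel (x1, x2)].
Definition rel_pre {T1 T2 : Type} (Rel : set (T1 * T2)) (X2 : set T2) : set T1 :=
  [set x1 | exists2 x2, X2 x2 & Rel (x1, x2)].
Definition rel_total {T1 T2 : Type} (Rel : set (T1 * T2)) : Prop :=
  rel_img Rel setT = setT /\ rel_pre Rel setT = setT.

Definition ker_pair {R : realType} {r n1 n2 : nat}
  (M1 : 'M[R]_(r, n1)) (M2 : 'M[R]_(r, n2)) : set ('cV[R]_n1 * 'cV[R]_n2) :=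
  [set x | row_mx M1 (- M2) *m col_mx x.1 x.2 = 0].

(* Reach(A,G) = [G  AG  ...  A^(k-1) G] (k blocks) *)
Fixpoint reach_aux {R : realType} {n l : nat} (A : 'M[R]_n) (G : 'M[R]_(n, l))
  (k : nat) : 'M[R]_(n, k * l) :=
  match k return 'M[R]_(n, k * l) with
  | 0 => 0
  | k'.+1 => row_mx G (A *m reach_aux A G k')
  end.
Definition Reach {R : realType} {n l : nat} (A : 'M[R]_n) (G : 'M[R]_(n, l)) :
  'M[R]_(n, n * l) := reach_aux A G n.

Definition stoch_bisim {R : realType} {d1 d2} {Om1 : measurableType d1}
  {Om2 : measurableType d2} (P1 : probability Om1 R) (P2 : probability Om2 R)
  {n1 n2 m l1 l2 p : nat}
  (A1 : 'M[R]_n1) (B1 : 'M[R]_(n1, m)) (G1 : 'M[R]_(n1, l1)) (C1 : 'M[R]_(p, n1))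
  (w1 : nat -> Om1 -> 'cV[R]_l1) (nu1 : nat -> Om1 -> 'cV[R]_p)
  (A2 : 'M[R]_n2) (B2 : 'M[R]_(n2, m)) (G2 : 'M[R]_(n2, l2)) (C2 : 'M[R]_(p, n2))
  (w2 : nat -> Om2 -> 'cV[R]_l2) (nu2 : nat -> Om2 -> 'cV[R]_p)
  (Rel : set ('cV[R]_n1 * 'cV[R]_n2)) : Prop :=
  forall (x10 : 'cV[R]_n1) (x20 : 'cV[R]_n2) (u : nat -> 'cV[R]_m) (t : nat),
    Rel (x10, x20) ->
    let x1 := state_proc A1 B1 G1 w1 x10 u t in
    let x2 := state_proc A2 B2 G2 w2 x20 u t in
    [/\ (forall X1 : set 'cV[R]_n1, Borel X1 -> X1 `<=` rel_pre Rel setT ->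
           P1 [set om | X1 (x1 om)] =
           P2 [set om | rel_img Rel (X1 `&` supp P1 x1) (x2 om)]),
        (forall X2 : set 'cV[R]_n2, Borel X2 -> X2 `<=` rel_img Rel setT ->
           P2 [set om | X2 (x2 om)] =
           P1 [set om | rel_pre Rel (X2 `&` supp P2 x2) (x1 om)]) &
        stoch_equiv P1 P2 (output_proc A1 B1 G1 C1 w1 nu1 x10 u)
                          (output_proc A2 B2 G2 C2 w2 nu2 x20 u)].

(* Main.v *)
Require Import Defs.
From HB Require Import structures.
From mathcomp Require Import all_boot all_order all_algebra.
From mathcomp Require Import all_classical all_reals all_analysis.
From mathcomp Require Import measurable_realfun ring lra.
Import Order.TTheory GRing.Theory Num.Theory.
Import numFieldTopology.Exports.
Local Open Scope classical_set_scope.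
Local Open Scope ring_scope.

Set Implicit Arguments.
Unset Strict Implicit.
Unset Printing Implicit Defensive.

(** A total invariant [ker [R1 -R2]] makes both projected states [z = R_i x_i]
    follow one recursion with a common matrix, so under (h1)-(h4) every linear
    functional of the projected states and outputs is the same affine combination
    of independent Gaussian noises for both systems; linear functionals determine
    the law (Cramer-Wold), hence the laws agree.  The state is supported exactly on
    the affine space [mean + im reach]; (h5) says that [R_i] is injective there, so
    the images occurring in (i) and (ii) are preimages under a linear left inverse.
    Conversely, testing (i) on [R1]-saturated sets equates the laws of the projected
    states, and one step from the origin identifies means and covariances.  If [R1]
    collapsed a reachable direction, a half-space of probability below one would
    have an image of probability one.

    Cramer-Wold is obtained without Fourier inversion: functions that two laws
    integrate alike against every cosine are stable under multiplication by
    [y = (1 + cos) / 2] and bounded limits, and [(1 - y^n)^(n 2^n)] converges to the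
    indicator of [y < 1/2]; stretching the cosines then yields half-spaces. *)

(** * Borel sets of matrices *)

(** The sets on the right of (i) and (ii) are images of Borel sets under a linear relation. Such
    images are in general only analytic, so nothing guarantees that they are events. For
    sufficiency, injectivity on reachable directions turns the image into an explicit Borel set. For
    necessity, where injectivity is still to be proved, only sets with a computable image are
    tested: the whole space, saturated sets and one half-space. Equality in law is not stable under
    sums. The two systems are therefore compared through functionals with literally the same
    coefficients, a property that is stable under sums, and laws are taken only at the end.
    Variances may vanish, since a functional can kill the noise and [Psi] may be singular; hence the
    Dirac cases. (h5) involves [n_i] blocks, while the state at time [t] involves [t] blocks.
    Cayley-Hamilton places the directions reachable at any time inside the image of [Reach];
    conversely, time [n_i] alone yields (h5). *)

Section borel_matrix.
Context {R : realType} {m n : nat}.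
Implicit Types (a b M : 'M[R]_(m, n)).

Definition open_box a b : set 'M[R]_(m, n) :=
  [set M | forall i j, a i j < M i j < b i j].

Lemma open_open_box a b : open (open_box a b).
Proof.
rewrite openE => M Mab; rewrite /interior.
exists (fun i j => [set x | a i j < x < b i j]) => // i j.
have -> : [set x | a i j < x < b i j] = `]a i j, b i j[%classic.
  by apply/seteqP; split => x /=; rewrite in_itv.
by apply: open_nbhs_nbhs; split; [exact: itv_open|rewrite /= in_itv/= Mab].
Qed.

Lemma Borel_open (U : set 'M[R]_(m, n)) : open U -> Borel U.
Proof. exact: sub_sigma_algebra. Qed.

Lemma Borel_closed (U : set 'M[R]_(m, n)) : closed U -> Borel U.
Proof.
move=> cU; rewrite -(setCK U) -setTD; apply: sigma_algebraCD.
by apply: Borel_open; exact: closed_openC.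
Qed.

(** Boxes with rational corners that lie inside [U] already cover [U], and there are only countably
    many of them. *)
Lemma open_box_sigma (U : set 'M[R]_(m, n)) : open U ->
  <<s [set open_box a b | a in setT & b in setT] >> U.
Proof.
move=> oU; set G := (X in <<s X >>).
pose q2r (q : 'M[rat]_(m, n)) : 'M[R]_(m, n) := map_mx ratr q.
(* The union runs over all rational pairs; a pair whose box leaves [U] contributes the empty set. *)
pose F (q : 'M[rat]_(m, n) * 'M[rat]_(m, n)) : set (g_sigma_algebraType G) :=
  [set M | open_box (q2r q.1) (q2r q.2) M /\ open_box (q2r q.1) (q2r q.2) `<=` U].
have -> : U = \bigcup_q F q.
  apply/seteqP; split => [M UM|M [q _ [/[swap]]]]; last exact.
  have /nbhs_ballP[e /= e0 eU] : nbhs M U by apply: open_nbhs_nbhs.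
  have lq i j : {q : rat | ratr q \in `]M i j - e, M i j[}.
    by apply/cid/rat_in_itvoo; rewrite ltrBlDr ltrDl.
  have uq i j : {q : rat | ratr q \in `]M i j, M i j + e[}.
    by apply/cid/rat_in_itvoo; rewrite ltrDl.
  exists (\matrix_(i, j) sval (lq i j), \matrix_(i, j) sval (uq i j)) => //.
  split => [i j|N MN]; rewrite /q2r /=.
    rewrite !mxE; case: (lq i j) => q /=; rewrite in_itv/= => /andP[_ ->].
    by case: (uq i j) => q' /=; rewrite in_itv/= => /andP[].
  apply: eU; split => // i j; move: (MN i j); rewrite /q2r !mxE /=.
  case: (lq i j) => q /=; rewrite in_itv/= => /andP[q1 q2].
  case: (uq i j) => q' /=; rewrite in_itv/= => /andP[q3 q4] /andP[h1 h2].
  by rewrite /ball /= ltr_norml; apply/andP; split; lra.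
apply: (@countable_bigcupT_measurable _ (g_sigma_algebraType G)) => // q.
rewrite /F; have [qU|qU] := pselect (open_box (q2r q.1) (q2r q.2) `<=` U).
  rewrite [X in measurable X](_ : _ = open_box (q2r q.1) (q2r q.2)).
    by apply: sub_sigma_algebra; do 2 eexists.
  by apply/seteqP; split => [x []|x] //.
rewrite [X in measurable X](_ : _ = set0); first exact: measurable0.
by apply/seteqP; split => x // -[].
Qed.

Lemma Borel_sub_open_box :
  @Borel 'M[R]_(m, n) `<=` <<s [set open_box a b | a in setT & b in setT] >>.
Proof. by apply: smallest_sub => // U; exact: open_box_sigma. Qed.

Lemma open_box_setI : setI_closed [set open_box a b | a in setT & b in setT].
Proof.
move=> _ _ [a _ [b _ <-]] [a' _ [b' _ <-]].
exists (\matrix_(i, j) Num.max (a i j) (a' i j)) => //.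
exists (\matrix_(i, j) Num.min (b i j) (b' i j)) => //.
apply/seteqP; split=> [M h|M [h h'] i j].
  by split=> i j; move: (h i j); rewrite !mxE gt_max lt_min;
    case/andP=> /andP[h1 h2] /andP[h3 h4]; apply/andP.
by rewrite !mxE gt_max lt_min; case/andP: (h i j) => -> ->; case/andP: (h' i j) => -> ->.
Qed.

End borel_matrix.

(** The Frobenius pairing, that is the trace of [a^T M]. Matrices rather than vectors are needed
    because a joint sample of outputs is a [p] by [k] matrix. *)
Definition mxlin {R : realType} {m n : nat} (a M : 'M[R]_(m, n)) : R :=
  \sum_i \sum_j a i j * M i j.

Section mxlin.
Context {R : realType} {m n : nat}.
Implicit Types a b M : 'M[R]_(m, n).

Lemma mxlinD a b M : mxlin (a + b) M = mxlin a M + mxlin b M.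
Proof.
rewrite /mxlin -big_split; apply: eq_bigr => i _ /=.
by rewrite -big_split; apply: eq_bigr => j _ /=; rewrite mxE mulrDl.
Qed.

Lemma mxlinZ (c : R) a M : mxlin (c *: a) M = c * mxlin a M.
Proof.
rewrite /mxlin big_distrr; apply: eq_bigr => i _ /=.
by rewrite big_distrr; apply: eq_bigr => j _ /=; rewrite mxE mulrA.
Qed.

Lemma mxlinB a b M : mxlin (a - b) M = mxlin a M - mxlin b M.
Proof. by rewrite mxlinD -scaleN1r mxlinZ mulN1r. Qed.

Lemma mxlin_delta (i : 'I_m) (j : 'I_n) M : mxlin (delta_mx i j) M = M i j.
Proof.
rewrite /mxlin (bigD1 i)//= (bigD1 j)//= !mxE !eqxx mul1r.
rewrite big1 ?addr0 => [|k /negbTE kj]; last by rewrite mxE kj andbF mul0r.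
rewrite big1 ?addr0// => k /negbTE ki.
by rewrite big1// => l _; rewrite mxE ki mul0r.
Qed.

End mxlin.

Section random_matrix.
Context {R : realType} {d : measure_display} {Om : measurableType d} {m n : nat}.
Implicit Types X : Om -> 'M[R]_(m, n).

(** Unfolds to [random_vec] on column vectors, so hypotheses on the noise apply directly. *)
Definition random_mx X := forall S, Borel S -> measurable (X @^-1` S).

Lemma random_mxP X :
  random_mx X <-> forall i j, measurable_fun setT (fun om => X om i j).
Proof.
split=> [mX i j|mX].
  apply: (measurability _ (RGenOpens.measurableE R)) => // _ [_ [x [y ->] <-]].
  rewrite setTI; apply: (mX [set M | `]x, y[%classic (M i j)]).
  apply: Borel_open; apply: (open_comp _ (itv_open x y)) => M _.
  exact: coord_continuous.
suff h : <<s [set open_box a b | a in setT & b in setT] >> `<=`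
   [set S : set 'M[R]_(m, n) | measurable (X @^-1` S)].
  by move=> S /Borel_sub_open_box /h.
apply: smallest_sub => [|_ [a _ [b _ <-]]] /=.
  split => [|A mA|F mF] /=.
  - by rewrite preimage_set0.
  - by rewrite setTD preimage_setC; exact: measurableC.
  - by rewrite preimage_bigcup; exact: bigcupT_measurable.
rewrite (_ : _ @^-1` _ = \bigcap_(ij : 'I_m * 'I_n)
   ((fun om => X om ij.1 ij.2) @^-1` `]a ij.1 ij.2, b ij.1 ij.2[%classic)).
  apply: fin_bigcap_measurable => [|ij _]; first exact: finite_finset.
  by rewrite -[X in measurable X]setTI; apply: mX.
apply/seteqP; split => [om h ij _|om h i j] /=; first by rewrite in_itv/=; apply: h.
by have := h (i, j) I; rewrite /= in_itv.
Qed.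

Lemma measurable_mxlin X (a : 'M[R]_(m, n)) : random_mx X ->
  measurable_fun setT (fun om => mxlin a (X om)).
Proof.
move/random_mxP => mX; apply: measurable_sum => i; apply: measurable_sum => j.
exact: measurable_funM.
Qed.

End random_matrix.

(* Boxes form a pi-system generating the Borel sets. *)
Lemma eq_law_open_box {R : realType} {d1 d2 : measure_display}
    {Om1 : measurableType d1} {Om2 : measurableType d2}
    (P1 : probability Om1 R) (P2 : probability Om2 R) {m n : nat}
    (X : Om1 -> 'M[R]_(m, n)) (Y : Om2 -> 'M[R]_(m, n)) :
  random_mx X -> random_mx Y ->
  (forall a b, P1 (X @^-1` open_box a b) = P2 (Y @^-1` open_box a b)) ->
  forall S, Borel S -> P1 (X @^-1` S) = P2 (Y @^-1` S).
Proof.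
move=> mX mY XY.
pose H := [set S : set 'M[R]_(m, n) | [/\ measurable (X @^-1` S),
  measurable (Y @^-1` S) & P1 (X @^-1` S) = P2 (Y @^-1` S)]].
suff h : <<s [set open_box a b | a in setT & b in setT] >> `<=` H.
  by move=> S /Borel_sub_open_box /h[].
apply: lambda_system_subset => //; first exact: open_box_setI; last first.
  move=> _ [a _ [b _ <-]]; have oab := Borel_open (@open_open_box _ _ _ a b).
  by split; [exact: mX|exact: mY|exact: XY].
split => //.
- split; [exact: measurableT|exact: measurableT|].
  by rewrite !preimage_setT !probability_setT.
- move=> A B BA [mA1 mA2 PA] [mB1 mB2 PB]; split.
  + exact: (measurableD mA1 mB1).
  + exact: (measurableD mA2 mB2).
  + have D (T : Type) (f : T -> 'M[R]_(m, n)) :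
      f @^-1` (A `\` B) = (f @^-1` A) `\` (f @^-1` B) by [].
    rewrite !D !measureD//; last 2 first.
      by rewrite (le_lt_trans (probability_le1 _ _)) ?ltry.
      by rewrite (le_lt_trans (probability_le1 _ _)) ?ltry.
    rewrite !setIidr; do ?by move=> x; exact: BA.
    by congr (_ - _)%E; [exact: PA|exact: PB].
- move=> F ndF HF.
  have m1 k : measurable (X @^-1` F k) by case: (HF k).
  have m2 k : measurable (Y @^-1` F k) by case: (HF k).
  split; rewrite ?preimage_bigcup; do ?exact: bigcupT_measurable.
  have nd1 : nondecreasing_seq (fun k => X @^-1` F k).
    by move=> i j /ndF/subsetPset ij; apply/subsetPset => x; exact: ij.
  have nd2 : nondecreasing_seq (fun k => Y @^-1` F k).
    by move=> i j /ndF/subsetPset ij; apply/subsetPset => x; exact: ij.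
  have c1 := nondecreasing_cvg_mu (mu := P1) m1 (bigcupT_measurable _ m1) nd1.
  have c2 := nondecreasing_cvg_mu (mu := P2) m2 (bigcupT_measurable _ m2) nd2.
  rewrite (_ : P1 \o _ = P2 \o (fun k => Y @^-1` F k)) in c1; last first.
    by apply/funext => k /=; case: (HF k).
  by rewrite -(cvg_lim _ c1)// -(cvg_lim _ c2).
Qed.

(** * Cramer-Wold *)

Section threshold.
Context {R : realType}.
Implicit Types x y w : R.

Lemma bernoulli_ge x k : 0 <= x <= 1 -> 1 - k%:R * x <= (1 - x) ^+ k.
Proof.
move=> /andP[x0 x1]; elim: k => [|k ih]; first by rewrite mul0r subr0 expr0.
have k0 : 0 <= k%:R :> R by [].
have h : (1 - k%:R * x) * (1 - x) <= (1 - x) ^+ k.+1.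
  by rewrite exprSr ler_wpM2r// subr_ge0.
apply: le_trans h; rewrite -natr1.
suff : 0 <= k%:R * x * x by lra.
by rewrite !mulr_ge0.
Qed.

(** Each of the [k] terms of the geometric sum [1 + w + ... + w^(k-1)] is at least [w^k], and that
    sum equals [(1 - w^k) / (1 - w)]. *)
Lemma natmul_expr_bound w k : 0 <= w -> w < 1 -> k%:R * w ^+ k <= (1 - w)^-1.
Proof.
move=> w0 w1; rewrite -[leRHS]mul1r ler_pdivlMr ?subr_gt0//.
suff : k%:R * w ^+ k * (1 - w) <= 1 - w ^+ k.
  by move/le_trans; apply; rewrite gerBl exprn_ge0.
elim: k => [|k ih]; first by rewrite !mul0r expr0 subrr.
have wk0 : 0 <= w ^+ k by rewrite exprn_ge0.
have := ler_wpM2l w0 ih; rewrite exprS -natr1 => h.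
have : w * (1 - w * w ^+ k) <= 1 * (1 - w * w ^+ k).
  apply: ler_wpM2r; last exact: ltW.
  by rewrite subr_ge0 -exprS exprn_ile1// ltW.
by lra.
Qed.

(** With [z = w^2], one factor [w^k] absorbs [k] by the previous bound and the other tends to 0. *)
Lemma cvg_natmul_expr z : 0 <= z -> z < 1 -> (fun k => k%:R * z ^+ k : R) @ \oo --> (0 : R).
Proof.
move=> z0 z1; pose w := Num.sqrt z.
have w0 : 0 <= w by exact: sqrtr_ge0.
have w1 : w < 1 by rewrite /w -sqrtr1 ltr_sqrt.
have zw : z = w * w by rewrite -expr2 sqr_sqrtr.
apply: (@squeeze_cvgr _ _ _ _ (cst 0) (fun k => (1 - w)^-1 * w ^+ k)).
- apply: nearW => k /=; rewrite mulr_ge0 ?exprn_ge0//=.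
  by rewrite zw exprMn mulrA ler_wpM2r ?exprn_ge0// natmul_expr_bound.
- exact: cvg_cst.
- rewrite -[X in _ --> X](mulr0 (1 - w)^-1); apply: cvgM; first exact: cvg_cst.
  by apply: cvg_expr; rewrite ger0_norm.
Qed.

(* The exponent [n 2^n] makes the threshold [1/2] sharp, including at [y = 1/2]. *)
Lemma cvg_threshold y : 0 <= y <= 1 ->
  (fun n : nat => (1 - y ^+ n) ^+ (n * 2 ^ n)%N) @ \oo --> ((y < 2^-1)%R%:R : R).
Proof.
move=> /andP[y0 y1].
have yn n : 0 <= y ^+ n <= 1 by rewrite exprn_ge0//= exprn_ile1.
have [yh|yh] := ltP y 2^-1.
  (* Bernoulli's inequality with exponent [n 2^n] gives the lower bound [1 - n (2y)^n], and here
     [2y < 1]. *)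
  apply: (@squeeze_cvgr _ _ _ _ (fun n => 1 - n%:R * (2 * y) ^+ n) (cst 1)).
  - apply: nearW => n /=; apply/andP; split.
      have := bernoulli_ge (n * 2 ^ n) (yn n).
      by rewrite natrM natrX exprMn mulrA.
    by case/andP: (yn n) => *; rewrite exprn_ile1 ?gerBl// subr_ge0.
  - rewrite -[X in _ --> X](subr0 1); apply: cvgB; first exact: cvg_cst.
    by apply: cvg_natmul_expr; [rewrite mulr_ge0|lra].
  - exact: cvg_cst.
(* Since [1 - s <= exp(-s)], the power is at most [exp(-n (2y)^n)]; as [2y >= 1], this is at most
   [exp(-n)]. The factor [n] is what handles [y = 1/2]. *)
apply: (@squeeze_cvgr _ _ _ _ (cst 0) (fun n => (expR (- 1)) ^+ n)).
- apply: nearW => n /=; case/andP: (yn n) => yn0 yn1.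
  rewrite exprn_ge0/= ?subr_ge0//.
  have /le_trans : (1 - y ^+ n) ^+ (n * 2 ^ n)%N <= expR (- y ^+ n) ^+ (n * 2 ^ n)%N.
    by rewrite lerXn2r ?nnegrE ?expR_ge0 ?subr_ge0// expR_ge1Dx.
  apply; rewrite -!expRM_natl ler_expR !mulrN lerN2 mulr1 natrM natrX -mulrA.
  rewrite ler_peMr// -exprMn exprn_ege1//; lra.
- exact: cvg_cst.
- by apply: cvg_expr; rewrite ger0_norm ?expR_ge0// expR_lt1; lra.
Qed.

(** As soon as [|x| / (k + 1) < pi], the sine has the sign of [x], so the sequence is eventually
    constant. *)
Lemma cvg_sin_sign x :
  (fun k => (sin (x / k.+1%:R) < 0)%R%:R : R) @ \oo --> ((x < 0)%R%:R : R).
Proof.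
apply: cvg_near_cst.
have c : (fun k => `|x| / k.+1%:R) @ \oo --> (0 : R).
  rewrite -[X in _ --> X](mulr0 `|x|); apply: cvgM; first exact: cvg_cst.
  exact: cvg_harmonic.
have pi0 : 0 < pi :> R by exact: pi_gt0.
near=> k; congr (_%:R); congr nat_of_bool.
have kpi : `|x| / k.+1%:R < pi.
  near: k; apply: (cvgr_lt 0 c); exact: pi_gt0.
have [x0|x0|->] := ltgtP x 0; last by rewrite mul0r sin0 ltxx.
- rewrite -[x]opprK mulNr sinN oppr_lt0 sin_gt0_pi// divr_gt0 ?oppr_gt0//=.
  by rewrite -(ltr0_norm x0).
- apply/negbTE; rewrite -leNgt ltW// sin_gt0_pi// divr_gt0//=.
  by rewrite -(gtr0_norm x0).
Unshelve. all: by end_near. Qed.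

End threshold.

Section bounded_integrals.
Context {R : realType} {d : measure_display} {Om : measurableType d}.
Variable P : probability Om R.

Lemma bounded_integrable (f : Om -> R) (C : R) : measurable_fun setT f ->
  (forall om, `|f om| <= C) -> P.-integrable setT (EFin \o f).
Proof.
move=> mf fC; apply: (@le_integrable _ _ _ _ _ _ _ (EFin \o cst C)) => //.
- exact/measurable_EFinP.
- by move=> om _ /=; rewrite lee_fin (le_trans (fC _))// ler_norm.
- exact: (finite_measure_integrable_cst P C measurableT).
Qed.

Lemma bounded_cvg_Rintegral (f_ : nat -> Om -> R) (f : Om -> R) (C : R) :
  (forall n, measurable_fun setT (f_ n)) -> (forall n om, `|f_ n om| <= C) ->
  (forall om, f_ ^~ om @ \oo --> f om) ->
  \int[P]_om f_ n om @[n --> \oo] --> \int[P]_om f om.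
Proof.
move=> mf fC ff.
have c := @dominated_cvg _ _ _ P setT measurableT (fun n om => (f_ n om)%:E)
  (EFin \o f) (EFin \o cst C).
apply: fine_cvg; rewrite fineK; last first.
  have mf' : measurable_fun setT f by apply: (measurable_fun_cvg mf) => om _; exact: ff.
  apply: integrable_fin_num => //; apply: (@bounded_integrable _ C) => // om.
  have nf : `|f_ n om| @[n --> \oo] --> `|f om| by apply: cvg_norm; exact: ff.
  by rewrite -(cvg_lim _ nf)//; apply: limr_le => //; [apply: cvgP nf|apply: nearW].
apply: c => //.
- by move=> n; exact/measurable_EFinP.
- by move=> om _; apply: cvg_EFin; [exact: nearW|exact: ff].
- exact: (finite_measure_integrable_cst P C measurableT).
- by move=> n om _; rewrite lee_fin fC.
Qed.

Lemma integrable_EFinZl (f : Om -> R) (c : R) : P.-integrable setT (EFin \o f) ->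
  P.-integrable setT (EFin \o (fun om => c * f om)).
Proof.
move=> fi; have := integrableZl measurableT c fi.
by apply: eq_integrable => // x _; rewrite /= EFinM.
Qed.

End bounded_integrals.

Section eq_law_integral.
Context {R : realType} {d1 d2 : measure_display}.
Context {Om1 : measurableType d1} {Om2 : measurableType d2}.
Variables (P1 : probability Om1 R) (P2 : probability Om2 R).

Lemma eq_law_Rintegral (f1 : Om1 -> R) (f2 : Om2 -> R) (g : R -> R) (C : R) :
  measurable_fun setT f1 -> measurable_fun setT f2 -> measurable_fun setT g ->
  (forall x, `|g x| <= C) ->
  (forall B, measurable B -> P1 (f1 @^-1` B) = P2 (f2 @^-1` B)) ->
  \int[P1]_om g (f1 om) = \int[P2]_om g (f2 om).
Proof.
move=> mf1 mf2 mg gC eqf; congr fine.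
have E d (Om : measurableType d) (P : probability Om R) (f : Om -> R) :
    measurable_fun setT f ->
    (\int[P]_om (g (f om))%:E = \int[pushforward P f]_y (g y)%:E)%E.
  move=> mf; rewrite integral_pushforward//=; first exact/measurable_EFinP.
  apply: (@bounded_integrable _ _ _ _ _ C) => //.
  exact: measurableT_comp.
rewrite !E//; apply: eq_measure_integral => A mA _ /=.
exact: eqf.
Qed.

End eq_law_integral.

Section cramer_wold.
Context {R : realType} {d1 d2 : measure_display}.
Context {Om1 : measurableType d1} {Om2 : measurableType d2} {m n : nat}.
Variables (P1 : probability Om1 R) (P2 : probability Om2 R).
Variables (X : Om1 -> 'M[R]_(m, n)) (Y : Om2 -> 'M[R]_(m, n)).
Hypotheses (mX : random_mx X) (mY : random_mx Y).
Hypothesis XY : forall a B, measurable B ->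
  P1 [set om | B (mxlin a (X om))] = P2 [set om | B (mxlin a (Y om))].
Implicit Types (a b : 'M[R]_(m, n)) (f g : 'M[R]_(m, n) -> R).

Let mcos : measurable_fun setT (@cos R).
Proof. by apply: continuous_measurable_fun; exact: continuous_cos. Qed.

Let mcosX a phi : measurable_fun setT (fun om => cos (mxlin a (X om) + phi)).
Proof.
apply: (measurableT_comp mcos).
by apply: measurable_funD => //; exact: measurable_mxlin.
Qed.

Let mcosY a phi : measurable_fun setT (fun om => cos (mxlin a (Y om) + phi)).
Proof.
apply: (measurableT_comp mcos).
by apply: measurable_funD => //; exact: measurable_mxlin.
Qed.

(** Measurability is asked of the compositions with [X] and [Y], since the matrices carry no
    measurable structure here. The bound 1 survives products and pointwise limits and gives both
    integrability and bounded convergence. Arbitrary phases make the class of test functions closed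
    under shifting and cover the sine. *)
Definition cos_indistinguishable f :=
  [/\ measurable_fun setT (f \o X), measurable_fun setT (f \o Y),
      forall M, `|f M| <= 1 &
      forall a phi, \int[P1]_om (f (X om) * cos (mxlin a (X om) + phi)) =
                    \int[P2]_om (f (Y om) * cos (mxlin a (Y om) + phi))].
Local Notation K := cos_indistinguishable.

Let normM_le1 (x y : R) : `|x| <= 1 -> `|y| <= 1 -> `|x * y| <= 1.
Proof. by move=> x1 y1; rewrite normrM mulr_ile1. Qed.

Let cos_le1' (x : R) : `|cos x| <= 1.
Proof. by rewrite ler_norml cos_geN1 cos_le1. Qed.

Let intX f a phi : K f ->
  P1.-integrable setT (EFin \o (fun om => f (X om) * cos (mxlin a (X om) + phi))).
Proof.
case=> mf _ f1 _; apply: (@bounded_integrable _ _ _ _ _ 1).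
  exact: measurable_funM.
by move=> om; exact: normM_le1.
Qed.

Let intY f a phi : K f ->
  P2.-integrable setT (EFin \o (fun om => f (Y om) * cos (mxlin a (Y om) + phi))).
Proof.
case=> _ mf f1 _; apply: (@bounded_integrable _ _ _ _ _ 1).
  exact: measurable_funM.
by move=> om; exact: normM_le1.
Qed.

(** With the constant function 1 only the law of a single linear form is tested; this is where [XY]
    enters. *)
Let K1 : K (cst 1).
Proof.
split; [exact: measurable_cst|exact: measurable_cst|by move=> M; rewrite normr1|].
move=> a phi; under eq_Rintegral do rewrite mul1r.
under [RHS]eq_Rintegral do rewrite mul1r.
apply: (@eq_law_Rintegral _ _ _ _ _ _ _ (fun om => mxlin a (X om))
  (fun om => mxlin a (Y om)) (fun x => cos (x + phi)) 1) => //.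
- exact: measurable_mxlin.
- exact: measurable_mxlin.
- apply: (measurableT_comp mcos).
  exact: measurable_funD.
- by move=> B mB; exact: XY.
Qed.

Let Klin f g (c e : R) : K f -> K g ->
  (forall M, `|c * f M + e * g M| <= 1) -> K (fun M => c * f M + e * g M).
Proof.
move=> Kf Kg fg1; have [mf1 mf2 f1 f2] := Kf; have [mg1 mg2 g1 g2] := Kg.
split => //.
- by apply: measurable_funD; apply: measurable_funM.
- by apply: measurable_funD; apply: measurable_funM.
move=> a phi.
under eq_Rintegral do rewrite mulrDl -!mulrA.
under [RHS]eq_Rintegral do rewrite mulrDl -!mulrA.
rewrite !RintegralD//; try (apply: integrable_EFinZl; by [exact: intX|exact: intY]).
by rewrite !RintegralZl ?f2 ?g2//; by [exact: intX|exact: intY].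
Qed.

(** Product-to-sum: a product of two cosines is half the sum of the cosines at [a + b] and [a - b],
    with phases added and subtracted, so [f] is again tested against single cosines. *)
Let Kcos f b psi : K f -> K (fun M => f M * cos (mxlin b M + psi)).
Proof.
move=> Kf; have [mf1 mf2 f1 f2] := Kf; split.
- exact: measurable_funM.
- exact: measurable_funM.
- by move=> M; exact: normM_le1.
move=> a phi.
have E M : f M * cos (mxlin b M + psi) * cos (mxlin a M + phi) =
    2^-1 * (f M * cos (mxlin (a + b) M + (phi + psi))) +
    2^-1 * (f M * cos (mxlin (a - b) M + (phi - psi))).
  rewrite mxlinD mxlinB.
  have -> : mxlin a M + mxlin b M + (phi + psi) =
    (mxlin a M + phi) + (mxlin b M + psi) by ring.
  have -> : mxlin a M - mxlin b M + (phi - psi) =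
    (mxlin a M + phi) - (mxlin b M + psi) by ring.
  move: (mxlin a M + phi) (mxlin b M + psi) => x y.
  by rewrite cosD cosB; field.
under eq_Rintegral do rewrite E.
under [RHS]eq_Rintegral do rewrite E.
rewrite !RintegralD//; try (apply: integrable_EFinZl; by [exact: intX|exact: intY]).
by rewrite !RintegralZl ?f2//; by [exact: intX|exact: intY].
Qed.

Let Klim (f_ : nat -> 'M[R]_(m, n) -> R) f : (forall k, K (f_ k)) ->
  (forall M, f_ ^~ M @ \oo --> f M) -> K f.
Proof.
move=> Kf ff; split.
- apply: (measurable_fun_cvg (h := fun k => f_ k \o X)) => [k|om _].
    by case: (Kf k).
  exact: ff.
- apply: (measurable_fun_cvg (h := fun k => f_ k \o Y)) => [k|om _].
    by case: (Kf k).
  exact: ff.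
- move=> M; have nf : `|f_ k M| @[k --> \oo] --> `|f M| by apply: cvg_norm; exact: ff.
  rewrite -(cvg_lim _ nf)//; apply: limr_le; first by apply: cvgP nf.
  by apply: nearW => k; case: (Kf k).
move=> a phi.
have c1 := @bounded_cvg_Rintegral _ _ _ P1
  (fun k om => f_ k (X om) * cos (mxlin a (X om) + phi))
  (fun om => f (X om) * cos (mxlin a (X om) + phi)) 1.
have c2 := @bounded_cvg_Rintegral _ _ _ P2
  (fun k om => f_ k (Y om) * cos (mxlin a (Y om) + phi))
  (fun om => f (Y om) * cos (mxlin a (Y om) + phi)) 1.
apply: (@cvg_unique _ (@Rhausdorff R) _ _ _ _ (c1 _ _ _) _).
- by move=> k; have [] := Kf k => ? ? ? ?; exact: measurable_funM.
- by move=> k om; have [] := Kf k => ? ? ? ?; exact: normM_le1.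
- by move=> om; apply: cvgMl; exact: ff.
have -> : (fun k => \int[P1]_om (f_ k (X om) * cos (mxlin a (X om) + phi))) =
          (fun k => \int[P2]_om (f_ k (Y om) * cos (mxlin a (Y om) + phi))).
  by apply/funext => k; case: (Kf k) => _ _ _; exact.
apply: c2.
- by move=> k; have [] := Kf k => ? ? ? ?; exact: measurable_funM.
- by move=> k om; have [] := Kf k => ? ? ? ?; exact: normM_le1.
- by move=> om; apply: cvgMl; exact: ff.
Qed.

(** Normalised to take values in [0, 1] and to be below 1/2 exactly where the cosine is negative, as
    [cvg_threshold] requires. *)
Let wave b psi M : R := 2^-1 + 2^-1 * cos (mxlin b M + psi).

Let wave01 b psi M : 0 <= wave b psi M <= 1.
Proof.
rewrite /wave; have := cos_geN1 (mxlin b M + psi); have := cos_le1 (mxlin b M + psi).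
by move=> h1 h2; apply/andP; split; lra.
Qed.

Let Kwave f b psi k : K f -> K (fun M => f M * wave b psi M ^+ k).
Proof.
move=> Kf; have f1 : forall M, `|f M| <= 1 by case: Kf.
elim: k => [|k ih].
  by rewrite (_ : (fun M => _) = f)//; apply/funext => M; rewrite expr0 mulr1.
set g := fun M => f M * wave b psi M ^+ k in ih *.
have E M : 2^-1 * g M + 2^-1 * (g M * cos (mxlin b M + psi)) =
    f M * wave b psi M ^+ k.+1.
  by rewrite exprSr [X in _ * (_ * X)]/wave /g; ring.
rewrite (_ : (fun M => _) =
  (fun M => 2^-1 * g M + 2^-1 * (g M * cos (mxlin b M + psi)))); last first.
  by apply/funext => M; rewrite E.
apply: Klin => //; first exact: Kcos.
move=> M; rewrite E.
have /andP[w0 w1] := wave01 b psi M.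
by apply: normM_le1 => //; rewrite ger0_norm ?exprn_ge0// exprn_ile1.
Qed.

(** Multiplying by [1 - wave^l] is a difference of two members of the class, so all powers stay
    inside; the choice [l = n] and power [n 2^n] converges to the indicator. *)
Let Kthreshold f b psi : K f ->
  K (fun M => f M * (cos (mxlin b M + psi) < 0)%R%:R).
Proof.
move=> Kf.
have Kp l k : K (fun M => f M * (1 - wave b psi M ^+ l) ^+ k).
  elim: k => [|k ih].
    by rewrite (_ : (fun M => _) = f)//; apply/funext => M; rewrite expr0 mulr1.
  set g := fun M => f M * (1 - wave b psi M ^+ l) ^+ k in ih *.
  have f1 : forall M, `|f M| <= 1 by case: Kf.
  have E M : f M * (1 - wave b psi M ^+ l) ^+ k.+1 =
    1 * g M + (-1) * (g M * wave b psi M ^+ l) by rewrite /g exprSr; ring.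
  rewrite (_ : (fun M => _) = (fun M => 1 * g M + (-1) * (g M * wave b psi M ^+ l))).
    apply: Klin => //; first exact: Kwave.
    move=> M; rewrite -E; apply: normM_le1 => //.
    have /andP[w0 w1] := wave01 b psi M.
    rewrite ger0_norm ?exprn_ge0 ?exprn_ile1 ?subr_ge0 ?exprn_ile1//.
    by rewrite gerBl exprn_ge0.
  by apply/funext => M; rewrite E.
apply: (Klim (f_ := fun k M => f M * (1 - wave b psi M ^+ k) ^+ (k * 2 ^ k)%N)) => // M.
apply: cvgMr; have := cvg_threshold (wave01 b psi M).
suff -> : (wave b psi M < 2^-1)%R = (cos (mxlin b M + psi) < 0)%R by [].
by rewrite /wave; apply/idP/idP => ?; lra.
Qed.

(** A phase of [-pi/2] turns the cosine into a sine vanishing at [M i j = x]. Stretching it turns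
    the strips where it is negative into a half-space, whose side is chosen by the sign of [c]. *)
Let Khalf f i j (c x : R) : K f -> K (fun M => f M * (c * (M i j - x) < 0)%R%:R).
Proof.
move=> Kf.
apply: (Klim (f_ := fun k M => f M * (sin (c * (M i j - x) / k.+1%:R) < 0)%R%:R)).
  move=> k.
  have := Kthreshold ((c / k.+1%:R) *: delta_mx i j) (- (c * x / k.+1%:R) - pi / 2) Kf.
  congr K; apply/funext => M; rewrite addrA cosBpihalf mxlinZ mxlin_delta.
  by rewrite (_ : _ - _ = c * (M i j - x) / k.+1%:R)//; field.
by move=> M; apply: cvgMr; exact: cvg_sin_sign.
Qed.

(** The indicator of an open box is a finite product of half-space indicators, two for each entry,
    and these can be multiplied in one at a time. *)
Lemma cramer_wold : forall S, Borel S -> P1 (X @^-1` S) = P2 (Y @^-1` S).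
Proof.
apply: eq_law_open_box => // a b.
pose g (ij : 'I_m * 'I_n) (M : 'M[R]_(m, n)) : R :=
  ((-1) * (M ij.1 ij.2 - a ij.1 ij.2) < 0)%R%:R * (1 * (M ij.1 ij.2 - b ij.1 ij.2) < 0)%R%:R.
have Kg (s : seq ('I_m * 'I_n)) : K (fun M => \prod_(ij <- s) g ij M).
  elim: s => [|ij s ih].
    by rewrite (_ : (fun M => _) = cst 1)//; apply/funext => M; rewrite big_nil.
  rewrite (_ : (fun M => _) = (fun M => \prod_(ij <- s) g ij M *
     ((-1) * (M ij.1 ij.2 - a ij.1 ij.2) < 0)%R%:R * (1 * (M ij.1 ij.2 - b ij.1 ij.2) < 0)%R%:R)).
    by apply: (@Khalf (fun M => _ * _)); exact: Khalf.
  by apply/funext => M; rewrite big_cons /g mulrC mulrA.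
have E M : \prod_(ij <- enum {: 'I_m * 'I_n}) g ij M = \1_(open_box a b) M.
  rewrite indicE; have gE ij : g ij M = (a ij.1 ij.2 < M ij.1 ij.2 < b ij.1 ij.2)%R%:R.
    rewrite /g mul1r mulN1r oppr_lt0 subr_gt0 subr_lt0.
    by case: (_ < _)%R; rewrite ?mul1r ?mul0r.
  have [Mab|Mab] := pselect (open_box a b M).
    rewrite mem_set// big1// => -[i j] _.
    by rewrite gE /= Mab.
  rewrite memNset//; apply/eqP; rewrite prodf_seq_eq0.
  have [i] : exists i, ~ forall j, a i j < M i j < b i j by apply/existsNP.
  move/existsNP => [j /negP Mij]; apply/hasP; exists (i, j); first by rewrite mem_enum.
  by rewrite gE/= (negbTE Mij).
(* At [a = 0] and phase 0 the test cosine is 1, which leaves the probability of the box. *)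
have [_ _ _ /(_ 0 0)] := Kg (enum {: 'I_m * 'I_n}).
have mxlin0 M : mxlin 0 M = 0 by rewrite -(scale0r 0) mxlinZ mul0r.
under eq_Rintegral do rewrite mxlin0 addr0 cos0 mulr1 E.
under [RHS]eq_Rintegral do rewrite mxlin0 addr0 cos0 mulr1 E.
have ob := Borel_open (@open_open_box _ _ _ a b).
have IE d (Om : measurableType d) (P : probability Om R) (Z : Om -> 'M[R]_(m, n)) :
    measurable (Z @^-1` open_box a b) ->
    (\int[P]_om (\1_(open_box a b) (Z om))%:E = P (Z @^-1` open_box a b))%E.
  by move=> mZ; rewrite -[in RHS](setIT (Z @^-1` _)) -integral_indic.
rewrite /Rintegral !IE; [|exact: mY|exact: mX].
move=> h; rewrite -[LHS]fineK ?h ?fineK//; apply: fin_num_measure.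
- exact: mY.
- exact: mX.
Qed.

End cramer_wold.

(** * Sums of independent Gaussian variables *)

Section gaussian_measure.
Context {R : realType}.
Local Notation mu := (@lebesgue_measure R).
Implicit Types (m v s c : R) (B : set R).

(** [gauss_law] is a bare set function; integrating against it and forming products requires a
    bundled probability. *)
Definition gaussP m v : probability (measurableTypeR R) R :=
  if v == 0 then (@dirac _ (measurableTypeR R) m R : probability (measurableTypeR R) R)
  else (normal_prob m (Num.sqrt v) : probability (measurableTypeR R) R).

Lemma gauss_lawE m v : gauss_law m v = gaussP m v.
Proof. by rewrite /gauss_law /gaussP; apply/funext => B; case: ifP. Qed.

Lemma gaussP0 m : gaussP m 0 = @dirac _ (measurableTypeR R) m R.
Proof. by rewrite /gaussP eqxx. Qed.

Lemma gaussPE m v : v != 0 -> gaussP m v = normal_prob m (Num.sqrt v).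
Proof. by move=> /negbTE v0; rewrite /gaussP v0. Qed.

(** The translate of Lebesgue measure agrees with it on half-open intervals, hence everywhere by
    uniqueness. *)
Lemma integral_addr (g : R -> \bar R) c : measurable_fun setT g ->
  (forall x, 0 <= g x)%E -> (\int[mu]_x g (x + c)%R = \int[mu]_x g x)%E.
Proof.
move=> mg g0; pose phi := (fun x : R => x + c) : R -> measurableTypeR R.
have mphi : measurable_fun setT phi by exact: measurable_funD.
transitivity (\int[pushforward mu phi]_x g x)%E.
  by rewrite ge0_integral_pushforward.
apply: eq_measure_integral => A mA _; apply/esym/lebesgue_measure_unique => //.
move=> _ [[a b]] _ <-.
transitivity (mu `]a - c, b - c]%classic).
  rewrite !lebesgue_measure_itv/= !lte_fin ltrD2r.
  by case: ifP => // _; congr (_%:E); ring.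
congr (mu _); apply/seteqP.
by split => x; rewrite /phi /= !in_itv/= ltrBlDr lerBrDr.
Qed.

(** The Radon-Nikodym derivative and the explicit density have equal integrals over every measurable
    set, so they agree almost everywhere. *)
Lemma integral_normal_prob m s (f : R -> \bar R) : s != 0 ->
  measurable_fun setT f -> (forall x, 0 <= f x <= 1)%E ->
  (\int[normal_prob m s]_x f x = \int[mu]_x (f x * (normal_pdf m s x)%:E))%E.
Proof.
move=> s0 mf f01.
have fi : (normal_prob m s).-integrable setT f.
  apply: (@le_integrable _ _ _ _ _ _ _ (EFin \o cst 1)) => //.
    by move=> x _ /=; case/andP: (f01 x) => *; rewrite gee0_abs// normr1.
  exact: (finite_measure_integrable_cst (normal_prob m s) 1 measurableT).
rewrite -(Radon_Nikodym_change_of_variables (normal_prob_dominates m s))//=.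
apply: ae_eq_integral => //.
- apply: emeasurable_funM => //; apply: (measurable_int mu).
  by apply: Radon_Nikodym_integrable; exact: normal_prob_dominates.
- apply: emeasurable_funM => //=; apply/measurableT_comp => //=.
  exact: measurable_normal_pdf.
- apply: ae_eqe_mul2l => /=.
  rewrite Radon_NikodymE//=; first exact: normal_prob_dominates.
  move=> dom; case: cid => /= h [h1 h2 h3].
  apply: integral_ae_eq => //=.
  + by apply/measurableT_comp =>//; exact: measurable_normal_pdf.
  + by move=> E _ mE; rewrite -h3.
Qed.

Lemma normal_prob_indic m s B : measurable B ->
  normal_prob m s B = (\int[mu]_x ((\1_B x)%:E * (normal_pdf m s x)%:E))%E.
Proof.
move=> mB; rewrite /normal_prob integral_mkcond; apply: eq_integral => x _.
rewrite patchE indicE; case: ifPn => _; by rewrite ?mul1e ?mul0e.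
Qed.

Let mshift c B : measurable B -> measurable [set y | B (c + y)].
Proof.
move=> mB; rewrite -[X in measurable X]setTI.
have mc : measurable_fun setT (fun y : R => c + y) by exact: measurable_funD.
exact: (mc measurableT _ mB).
Qed.

Let normal_prob_shift_integral m s c B : measurable B ->
  normal_prob m s [set y | B (c + y)] =
  (\int[mu]_x ((\1_B x)%:E * (normal_pdf m s (x - c))%:E))%E.
Proof.
move=> mB; rewrite normal_prob_indic; last exact: mshift.
rewrite -[RHS](@integral_addr _ c); last 2 first.
- apply: emeasurable_funM; first exact/measurable_EFinP/measurable_indic.
  apply/measurable_EFinP; apply: measurableT_comp; first exact: measurable_normal_pdf.
  exact: measurable_funB.
- by move=> x; rewrite mule_ge0// lee_fin normal_pdf_ge0.
apply: eq_integral => x _; rewrite addrK !indicE; congr (_%:R%:E * _)%E.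
by congr nat_of_bool; apply/idP/idP; rewrite !inE /= addrC.
Qed.

Lemma gaussP_shift m v c B : measurable B -> 0 <= v ->
  gaussP m v [set y | B (c + y)] = gaussP (c + m) v B.
Proof.
move=> mB v0; have [->|vn0] := eqVneq v 0.
  by rewrite !gaussP0 /= !diracE.
have s0 : Num.sqrt v != 0 by rewrite gt_eqF// sqrtr_gt0 lt_def vn0.
rewrite (gaussPE m vn0) (gaussPE _ vn0).
apply: (etrans (normal_prob_shift_integral m _ c mB)).
apply/esym/(etrans (normal_prob_indic _ _ mB)).
apply: eq_integral => x _.
by rewrite !normal_pdfE// /normal_fun opprD addrA.
Qed.

(* Completing the square. *)
Lemma normal_pdf_mul m1 m2 v1 v2 x y : 0 < v1 -> 0 < v2 ->
  normal_pdf m1 (Num.sqrt v1) x * normal_pdf m2 (Num.sqrt v2) (y - x) =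
  normal_pdf (m1 + m2) (Num.sqrt (v1 + v2)) y *
  normal_pdf (m1 + v1 * (y - m1 - m2) / (v1 + v2))
    (Num.sqrt (v1 * v2 / (v1 + v2))) x.
Proof.
move=> v1p v2p; have vp : 0 < v1 + v2 by exact: addr_gt0.
have wp : 0 < v1 * v2 / (v1 + v2) by rewrite divr_gt0 ?mulr_gt0.
have sn0 (w : R) : 0 < w -> Num.sqrt w != 0 by move=> w0; rewrite gt_eqF ?sqrtr_gt0.
rewrite !normal_pdfE ?sn0// /normal_peak /normal_fun !sqr_sqrtr ?ltW//.
rewrite mulrACA [RHS]mulrACA -!expRD -!invfM -!sqrtrM; last 2 first.
- by rewrite mulrn_wge0// mulr_ge0 ?pi_ge0// ltW.
- by rewrite mulrn_wge0// mulr_ge0 ?pi_ge0// ltW.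
congr ((Num.sqrt _)^-1 * expR _); field; by rewrite !gt_eqF.
Qed.

(** After exchanging the integrals, [normal_pdf_mul] splits the integrand into the density of the
    sum at [y] and a normal density in [x] (the conditional one given [y]), which integrates to
    1. *)
Let gaussP_conv_normal m1 m2 v1 v2 B : measurable B -> 0 < v1 -> 0 < v2 ->
  (\int[normal_prob m1 (Num.sqrt v1)]_x
     normal_prob m2 (Num.sqrt v2) [set y | B (x + y)%R] =
   normal_prob (m1 + m2) (Num.sqrt (v1 + v2)) B)%E.
Proof.
move=> mB v1p v2p; have vp : 0 < v1 + v2 by exact: addr_gt0.
have s1 : Num.sqrt v1 != 0 by rewrite gt_eqF ?sqrtr_gt0.
pose g (z : R * R) : \bar R := ((\1_B z.2)%:E *
  (normal_pdf m2 (Num.sqrt v2) (z.2 - z.1))%:E *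
  (normal_pdf m1 (Num.sqrt v1) z.1)%:E)%E.
have g0 z : (0 <= g z)%E.
  by rewrite !mule_ge0// lee_fin// normal_pdf_ge0.
have mg' : measurable_fun setT (fun z : R * R => (\1_B z.2)%:E *
  (normal_pdf m2 (Num.sqrt v2) (z.2 - z.1))%:E : \bar R)%E.
  apply: emeasurable_funM; apply/measurable_EFinP.
    by apply: measurableT_comp => //; exact: measurable_indic.
  apply: measurableT_comp; first exact: measurable_normal_pdf.
  exact: measurable_funB.
have mg : measurable_fun setT g.
  apply: emeasurable_funM => //; apply/measurable_EFinP.
  by apply: measurableT_comp => //; exact: measurable_normal_pdf.
transitivity (\int[mu]_x \int[mu]_y g (x, y))%E.
  have E x : normal_prob m2 (Num.sqrt v2) [set y | B (x + y)] =
      (\int[mu]_y ((\1_B y)%:E * (normal_pdf m2 (Num.sqrt v2) (y - x))%:E))%E.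
    exact: normal_prob_shift_integral.
  rewrite integral_normal_prob//; last 2 first.
  - under eq_fun do rewrite E.
    apply: (@measurable_fun_fubini_tonelli_F _ _ (measurableTypeR R) (measurableTypeR R)
      R mu (fun z : R * R => (\1_B z.2)%:E *
      (normal_pdf m2 (Num.sqrt v2) (z.2 - z.1))%:E : \bar R)%E) => //.
    by move=> z; rewrite mule_ge0// lee_fin// normal_pdf_ge0.
  - by move=> x; rewrite measure_ge0 probability_le1//; exact: mshift.
  apply: eq_integral => x _; rewrite E -ge0_integralZr//.
  - apply: emeasurable_funM; apply/measurable_EFinP; first exact: measurable_indic.
    apply: measurableT_comp; first exact: measurable_normal_pdf.
    exact: measurable_funB.
  - by move=> y _; rewrite mule_ge0// lee_fin// normal_pdf_ge0.
  - by rewrite lee_fin normal_pdf_ge0.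
rewrite (@fubini_tonelli _ _ (measurableTypeR R) (measurableTypeR R) R mu mu g)// normal_prob_indic//.
apply: eq_integral => y _.
have E x : g (x, y) = ((\1_B y)%:E * (normal_pdf (m1 + m2) (Num.sqrt (v1 + v2)) y)%:E *
    (normal_pdf (m1 + v1 * (y - m1 - m2) / (v1 + v2))
      (Num.sqrt (v1 * v2 / (v1 + v2))) x)%:E)%E.
  rewrite /g -!EFinM; congr EFin; rewrite -[RHS]mulrA -normal_pdf_mul//.
  by rewrite -[LHS]mulrA [X in _ * X = _]mulrC.
under eq_integral do rewrite E.
rewrite ge0_integralZl//=.
- by rewrite integral_normal_pdf mule1.
- by apply/measurable_EFinP; exact: measurable_normal_pdf.
- by move=> x _; rewrite lee_fin normal_pdf_ge0.
- by rewrite mule_ge0// lee_fin normal_pdf_ge0.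
Qed.

Lemma xsection_add B (x : R) :
  xsection [set z : R * R | B (z.1 + z.2)] x = [set y | B (x + y)].
Proof. by apply/seteqP; split => y; rewrite /xsection /= inE. Qed.

Lemma measurable_add_preimage B : measurable B ->
  measurable ([set z | B (z.1 + z.2)] : set (measurableTypeR R * measurableTypeR R)).
Proof.
move=> mB; rewrite -[X in measurable X]setTI.
have ma : measurable_fun setT (fun z : measurableTypeR R * measurableTypeR R =>
  z.1 + z.2 : R) by exact: measurable_funD.
exact: (ma measurableT _ mB).
Qed.

(** A vanishing first variance reduces to a shift of the second law; a vanishing second one makes
    the inner probability an indicator. Only two positive variances need the density computation. *)
Lemma gaussP_conv m1 m2 v1 v2 B : measurable B -> 0 <= v1 -> 0 <= v2 ->
  (\int[gaussP m1 v1]_x gaussP m2 v2 [set y | B (x + y)%R] =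
   gaussP (m1 + m2) (v1 + v2) B)%E.
Proof.
move=> mB v1p v2p; have [->|v1n0] := eqVneq v1 0.
  rewrite add0r; apply: (etrans _ (gaussP_shift m2 m1 mB v2p)).
  rewrite (gaussP0 m1) /= integral_dirac//.
    by rewrite diracT mul1e.
  have := measurable_fun_xsection (gaussP m2 v2) (measurable_add_preimage mB).
  by apply: eq_measurable_fun => x _ /=; rewrite xsection_add.
have v1gt : 0 < v1 by rewrite lt_def v1n0.
have [->|v2n0] := eqVneq v2 0.
  rewrite addr0 (addrC m1 m2); apply: (etrans _ (gaussP_shift m1 m2 mB v1p)).
  transitivity (\int[gaussP m1 v1]_x (\1_([set y | B (m2 + y)%R]) x)%:E)%E.
    apply: eq_integral => x _; rewrite (gaussP0 m2) /= diracE indicE.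
    congr (_%:R%:E); congr nat_of_bool.
    by apply/idP/idP; rewrite !inE /= addrC.
  by rewrite integral_indic ?setIT//; exact: mshift.
have v2gt : 0 < v2 by rewrite lt_def v2n0.
have vn0 : v1 + v2 != 0 by rewrite gt_eqF// addr_gt0.
rewrite (gaussPE m1 v1n0) (gaussPE m2 v2n0) (gaussPE _ vn0).
exact: gaussP_conv_normal.
Qed.

End gaussian_measure.

Section gaussian_sum.
Context {R : realType} {d : measure_display} {Om : measurableType d}.
Variable P : probability Om R.

(** [E] stands for the conditions on variables not yet added; carrying it along lets a sum be built
    one variable at a time. *)
Lemma gauss_law_add (X Y : Om -> R) (E : set Om) (m1 m2 v1 v2 : R) :
  measurable_fun setT X -> measurable_fun setT Y -> measurable E ->
  0 <= v1 -> 0 <= v2 ->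
  (forall B C : set R, measurable B -> measurable C ->
    P [set om | [/\ B (X om), C (Y om) & E om]] =
    gauss_law m1 v1 B * (gauss_law m2 v2 C * P E))%E ->
  forall B : set R, measurable B ->
    P [set om | B (X om + Y om) /\ E om] = (gauss_law (m1 + m2) (v1 + v2) B * P E)%E.
Proof.
move=> mX mY mE v1p v2p XY B mB.
pose XYf := (fun om => (X om, Y om)) : Om -> measurableTypeR R * measurableTypeR R.
have mXY : measurable_fun setT XYf by exact: measurable_fun_pair.
have PEfin : P E \is a fin_num by exact: fin_num_measure.
have PE0 : 0 <= fine (P E) by rewrite fine_ge0.
(* The law of the pair restricted to [E] has total mass [P E]. Scaling the second factor by this
   mass makes it a product measure on rectangles, hence everywhere. *)
pose m2' := mscale (NngNum PE0) (gaussP m2 v2).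
have m2E C : m2' C = (gaussP m2 v2 C * P E)%E.
  by rewrite /m2' /mscale/= fineK// muleC.
have := @product_measure_unique _ _ (measurableTypeR R) (measurableTypeR R) R
  (gaussP m1 v1) m2' (pushforward (mrestr P mE) XYf).
move=> /(_ mXY _ _ (measurable_add_preimage mB)) H; apply: etrans (etrans (esym (H _)) _).
- by [].
- move=> B' C mB' mC.
  apply: (etrans _ (esym (congr1 (fun x => gaussP m1 v1 B' * x)%E (m2E C)))).
  have := XY B' C mB' mC; rewrite (gauss_lawE m1 v1) (gauss_lawE m2 v2) => <-.
  by congr (P _); apply/seteqP; split => om /=; [case=> -[]|case].
transitivity (\int[gaussP m1 v1]_x (gaussP m2 v2 [set y | B (x + y)%R] * P E))%E.
  by apply: eq_integral => x _ /=; rewrite xsection_add; exact: m2E.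
have mg : measurable_fun setT (fun x : measurableTypeR R => gaussP m2 v2 [set y | B (x + y)]).
  have := measurable_fun_xsection (gaussP m2 v2) (measurable_add_preimage mB).
  by apply: eq_measurable_fun => x _ /=; rewrite xsection_add.
by rewrite ge0_integralZr// gaussP_conv// (gauss_lawE (m1 + m2)).
Qed.

Lemma gauss_law_sum (N : nat) (xi : nat -> Om -> R) (m v : nat -> R) (c : R) :
  (forall i, measurable_fun setT (xi i)) -> (forall i, 0 <= v i) ->
  (forall i B, measurable B -> P [set om | B (xi i om)] = gauss_law (m i) (v i) B) ->
  (forall B : nat -> set R, (forall i, measurable (B i)) ->
    P [set om | forall i, (i < N)%N -> B i (xi i om)] =
    \big[*%E/1%E]_(0 <= i < N) P [set om | B i (xi i om)])%E ->
  forall B, measurable B ->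
   P [set om | B (c + \sum_(i < N) xi i om)] =
   gauss_law (c + \sum_(i < N) m i) (\sum_(i < N) v i) B.
Proof.
move=> mxi v0 xiE ind.
have mtail k (B : nat -> set R) : (forall i, measurable (B i)) ->
    measurable [set om | forall i, (k <= i < N)%N -> B i (xi i om)].
  move=> mB.
  rewrite (_ : [set om | _] = \bigcap_(i in [set i | (k <= i < N)%N]) (xi i @^-1` B i)).
    apply: bigcap_measurableType => i _; rewrite -[X in measurable X]setTI.
    exact: mxi.
  by apply/seteqP; split => om h i; [move=> /= ki; exact: h|exact: h].
have indk k (B : nat -> set R) : (k <= N)%N -> (forall i, measurable (B i)) ->
    P [set om | forall i, (k <= i < N)%N -> B i (xi i om)] =
    (\big[*%E/1%E]_(k <= i < N) P [set om | B i (xi i om)])%E.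
  (* Indices below [k] receive the trivial constraint, whose factor in the product is 1. *)
  move=> kN mB; pose B' i := if (k <= i)%N then B i else setT.
  have := ind B'; rewrite (big_cat_nat (leq0n k) kN)/=.
  rewrite [X in (X * _)%E]big1_seq; last first.
    move=> i /andP[_]; rewrite mem_index_iota /= => ik; rewrite /B' leqNgt ik/=.
    by rewrite (_ : [set om | True] = setT) ?probability_setT//; apply/seteqP.
  rewrite mul1e => h; rewrite (_ : [set om | _] = [set om | forall i, (i < N)%N -> B' i (xi i om)]).
    rewrite h; last by move=> i; rewrite /B'; case: ifP.
    by apply: eq_big_nat => i /andP[ki _]; rewrite /B' ki.
  apply/seteqP; split => om /= hom i.
    by move=> iN; rewrite /B'; case: ifP => // ki; apply: hom; rewrite ki.
  by move=> /andP[ki iN]; have := hom i iN; rewrite /B' ki.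
(* The induction asserts that the partial sum is Gaussian and also independent of the later
   variables; the second half feeds the next step. *)
have key k : (k <= N)%N -> forall (B : set R) (C : nat -> set R), measurable B ->
    (forall i, measurable (C i)) ->
    P [set om | B (c + \sum_(i < k) xi i om) /\
                forall i, (k <= i < N)%N -> C i (xi i om)] =
    (gauss_law (c + \sum_(i < k) m i) (\sum_(i < k) v i) B *
     P [set om | forall i, (k <= i < N)%N -> C i (xi i om)])%E.
  elim: k => [_ B C mB mC|k ih kN B C mB mC].
    (* The empty sum is the constant [c], a Gaussian of variance 0. *)
    rewrite !big_ord0 addr0 /gauss_law eqxx diracE.
    have [Bc|Bc] := pselect (B c).
      rewrite mem_set// mul1e; congr (P _); apply/seteqP.
      by split => om /=; rewrite big_ord0 addr0; [case|].
    rewrite memNset// mul0e (_ : [set om | _] = set0) ?measure0//.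
    by apply/seteqP; split => om //=; rewrite big_ord0 addr0 => -[].
  under eq_set do rewrite big_ord_recr addrA.
  rewrite !big_ord_recr/= addrA.
  apply: gauss_law_add => //.
  - by apply: measurable_funD => //; apply: measurable_sum.
  - exact: mtail.
  - by apply: sumr_ge0.
  move=> B' C' mB' mC'.
  (* Puts the constraint on [xi k] back among the later ones, so that the induction hypothesis at
     [k] applies. *)
  pose C'' i := if i == k then C' else C i.
  have mC'' i : measurable (C'' i) by rewrite /C''; case: ifP.
  have EC : [set om | C' (xi k om) /\ forall i, (k < i < N)%N -> C i (xi i om)] =
      [set om | forall i, (k <= i < N)%N -> C'' i (xi i om)].
    apply/seteqP; split => om /=.
      move=> [h1 h2] i /andP[ki iN]; rewrite /C''; case: eqVneq => [->//|ik].
      by apply: h2; rewrite iN andbT ltn_neqAle eq_sym ik.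
    move=> h; split; first by have := h k; rewrite leqnn kN /C'' eqxx; exact.
    move=> i /andP[ki iN]; have := h i; rewrite (ltnW ki) iN /C'' gtn_eqF//.
    exact.
  have EP : P [set om | forall i, (k <= i < N)%N -> C'' i (xi i om)] =
      (P [set om | C' (xi k om)] *
       P [set om | forall i, (k < i < N)%N -> C i (xi i om)])%E.
    rewrite !indk ?(ltnW kN)// big_ltn// /C'' eqxx; congr (_ * _)%E.
    by apply: eq_big_nat => i /andP[ki _]; rewrite gtn_eqF.
  rewrite -(xiE k)// -EP -ih ?(ltnW kN)//; congr (P _).
  case/seteqP: EC => EC1 EC2; apply/seteqP; split => om /=.
    by case=> h1 h2 h3; split => //; apply: EC1.
  by case=> h1 /EC2[].
move=> B mB; have := key N (leqnn N) B (fun=> setT) mB (fun=> measurableT).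
rewrite [X in (_ * P X)%E](_ : _ = setT); last by apply/seteqP; split.
rewrite probability_setT mule1 => <-; congr (P _).
by apply/seteqP; split => om //= -[].
Qed.

End gaussian_sum.

(** * Positivity and identifiability of Gaussian laws on the line *)

Section gaussian_identification.
Context {R : realType}.
Local Notation mu := (@lebesgue_measure R).
Implicit Types (m v s c : R) (B : set R).

Lemma normal_prob_itvoo_gt0 m s (a b : R) : s != 0 -> a < b ->
  (0 < normal_prob m s `]a, b[%classic)%E.
Proof.
(* On the interval [|x - m|] is at most [|a - m| + |b - m|], so [e] bounds the density from below
   there. *)
move=> s0 ab; pose K := (`|a - m| + `|b - m|) ^+ 2.
pose e := normal_peak s * expR (- K / (s ^+ 2 *+ 2)).
have e0 : 0 < e by rewrite mulr_gt0 ?normal_peak_gt0 ?expR_gt0.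
apply: (@lt_le_trans _ _ (\int[mu]_(x in `]a, b[) (cst e%:E) x)%E).
  rewrite integral_cst//= lebesgue_measure_itv/= lte_fin ab -EFinD -EFinM lte_fin.
  by rewrite mulr_gt0// subr_gt0.
apply: ge0_le_integral => //=.
- by move=> x _; rewrite lee_fin ltW.
- by apply/measurable_funTS/measurable_EFinP; exact: measurable_normal_pdf.
- move=> x; rewrite in_itv/= => /andP[ax xb].
  rewrite lee_fin normal_pdfE// ler_wpM2l ?normal_peak_ge0// ler_expR.
  rewrite ler_wpM2r ?invr_ge0 ?mulrn_wge0 ?sqr_ge0// lerN2 -[leLHS]real_normK ?num_real//.
  rewrite lerXn2r ?nnegrE ?addr_ge0// ler_norml.
  have := ler_norm (a - m); have := ler_norm (b - m).
  have := ler_norm (- (a - m)); have := ler_norm (- (b - m)); rewrite !normrN.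
  by move=> h1 h2 h3 h4; apply/andP; split; lra.
Qed.

Lemma gauss_law_itvoo_gt0 m v (a b : R) : 0 < v -> a < b ->
  (0 < gauss_law m v `]a, b[%classic)%E.
Proof.
move=> v0 ab; rewrite /gauss_law gt_eqF//.
by apply: normal_prob_itvoo_gt0; rewrite // gt_eqF// sqrtr_gt0.
Qed.

(** The densities agree almost everywhere and are continuous; a point of disagreement would have a
    whole ball of them, of positive measure. *)
Lemma normal_prob_inj_pdf m m' s s' : s != 0 -> s' != 0 ->
  (forall B, measurable B -> normal_prob m s B = normal_prob m' s' B) ->
  normal_pdf m s = normal_pdf m' s'.
Proof.
move=> s0 s'0 eqB.
have mpdf a b : measurable_fun setT (fun x : R => (normal_pdf a b x)%:E).
  by apply/measurable_EFinP; exact: measurable_normal_pdf.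
have : ae_eq mu setT (fun x => (normal_pdf m s x)%:E) (fun x => (normal_pdf m' s' x)%:E).
  apply: (@integral_ae_eq _ (measurableTypeR R) R mu setT measurableT).
  - exact: integrable_normal_pdf.
  - exact: mpdf.
  - by move=> E _ mE; exact: eqB.
move=> [N [mN N0 subN]]; apply/funext => x; apply/eqP/negPn/negP => neq.
have /nbhs_ballP[e /= e0 eU] : \forall y \near x, normal_pdf m s y - normal_pdf m' s' y != 0.
  have c : {for x, continuous (fun y => normal_pdf m s y - normal_pdf m' s' y)}.
    by apply: cvgB; exact: continuous_normal_pdf.
  apply: (c [set z | z != 0]); apply: open_nbhs_nbhs; split; last by rewrite /= subr_eq0.
  exact: open_neq.
have : (mu (ball x e) <= mu N)%E.
  apply: le_measure; rewrite ?inE//; first exact: measurable_ball.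
  move=> y /eU yn; apply: subN => /= /(_ I) [] h.
  by move: yn; rewrite h subrr eqxx.
by rewrite N0 (lebesgue_measure_ball x (ltW e0)) leNgt lte_fin mulrn_wgt0.
Qed.

(** The maximal value of the density determines the variance, and the only point where it is
    attained is the mean. *)
Lemma normal_pdf_inj m m' s s' : s != 0 -> s' != 0 ->
  normal_pdf m s = normal_pdf m' s' -> m = m' /\ s ^+ 2 = s' ^+ 2.
Proof.
move=> s0 s'0 E.
have pm a b : b != 0 -> normal_pdf a b a = normal_peak b :> R.
  by move=> b0; rewrite normal_pdfE// /normal_fun subrr expr0n oppr0 mul0r expR0 mulr1.
have pk : normal_peak s = normal_peak s'.
  apply/eqP; rewrite eq_le -{1}(pm m s)// E normal_pdf_ub//=.
  by rewrite -(pm m' s')// -E normal_pdf_ub.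
split.
  have := congr1 (fun f => f m) E; rewrite pm// normal_pdfE// pk.
  rewrite -[X in X = _ -> _]mulr1 => /(mulfI _); rewrite gt_eqF ?normal_peak_gt0//.
  move=> /(_ isT); rewrite /normal_fun -expR0 => /expR_inj/esym/eqP; rewrite mulf_eq0 oppr_eq0 sqrf_eq0 subr_eq0.
  by rewrite invr_eq0 mulrn_eq0 /= sqrf_eq0 (negbTE s'0) orbF => /eqP.
move: pk => /invr_inj/(congr1 (fun x => x ^+ 2)).
have p0 (w : R) : 0 <= w ^+ 2 * pi *+ 2.
  by rewrite mulrn_wge0// mulr_ge0 ?sqr_ge0 ?pi_ge0.
rewrite !sqr_sqrtr//.
rewrite -(mulr_natr (s ^+ 2 * pi)) -(mulr_natr (s' ^+ 2 * pi)) => /mulIf; rewrite pnatr_eq0 => /(_ isT) /mulIf.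
by rewrite gt_eqF ?pi_gt0//; apply.
Qed.

(** Singletons separate the degenerate laws from the others: a Dirac mass charges its point, a
    density charges none. *)
Lemma gauss_law_inj m m' v v' : 0 <= v -> 0 <= v' ->
  (forall B, measurable B -> gauss_law m v B = gauss_law m' v' B) ->
  m = m' /\ v = v'.
Proof.
have normal_dirac a b w : 0 <= w -> w != 0 ->
    (forall B, measurable B -> (\d_a : set R -> \bar R) B = normal_prob b (Num.sqrt w) B) -> False.
  move=> _ _ /(_ [set a] (measurable_set1 a)).
  rewrite diracE mem_set//= /normal_prob integral_set1 => /eqP.
  by rewrite eqe oner_eq0.
move=> v0 v'0; rewrite /gauss_law.
have [->|vn] := eqVneq v 0; have [->|v'n] := eqVneq v' 0.
- move=> /(_ [set m] (measurable_set1 m)); rewrite !diracE mem_set//=.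
  case: (boolP (m' \in [set m])) => [|_ /eqP]; first by rewrite inE => ->.
  by rewrite eqe oner_eq0.
- by move=> /normal_dirac; case/(_ v'0 v'n).
- by move=> h; case: (@normal_dirac m' m v v0 vn) => B mB; rewrite h.
have sn w : 0 <= w -> w != 0 -> Num.sqrt w != 0 :> R.
  by move=> w0 wn; rewrite gt_eqF// sqrtr_gt0 lt_def wn.
move=> /normal_prob_inj_pdf => /(_ (sn _ v0 vn) (sn _ v'0 v'n)) /normal_pdf_inj.
by move=> /(_ (sn _ v0 vn) (sn _ v'0 v'n)); rewrite !sqr_sqrtr.
Qed.

End gaussian_identification.

(** * Noise and state processes *)

Section random_affine.
Context {R : realType} {d : measure_display} {Om : measurableType d}.

Lemma random_mx_mulmx m n k (M : 'M[R]_(m, n)) (X : Om -> 'M[R]_(n, k)) :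
  random_mx X -> random_mx (fun om => M *m X om).
Proof.
move/random_mxP => mX; apply/random_mxP => i j.
under eq_fun do rewrite mxE; apply: measurable_sum => l.
exact: measurable_funM.
Qed.

Lemma random_mxD m n (X Y : Om -> 'M[R]_(m, n)) :
  random_mx X -> random_mx Y -> random_mx (fun om => X om + Y om).
Proof.
move=> /random_mxP mX /random_mxP mY; apply/random_mxP => i j.
by under eq_fun do rewrite mxE; exact: measurable_funD.
Qed.

Lemma random_mx_cst m n (M : 'M[R]_(m, n)) : random_mx (fun _ : Om => M).
Proof. by apply/random_mxP => i j; exact: measurable_cst. Qed.

Lemma random_mx_mulmx_entry n (b : 'rV[R]_n) (X : Om -> 'cV[R]_n) :
  random_mx X -> measurable_fun setT (fun om => (b *m X om) ord0 ord0).
Proof. by move=> mX; have /random_mxP := random_mx_mulmx b mX; exact. Qed.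

End random_affine.

Section borel_preimage.
Context {R : realType} {m n : nat}.

Let borelT := g_sigma_algebraType [set U : set 'M[R]_(m, n) | open U].

(** With the Borel sigma-algebra put on the matrices themselves, closure properties of random
    matrices become closure properties of Borel sets. *)
Lemma random_mx_id : random_mx (id : borelT -> 'M[R]_(m, n)).
Proof. by []. Qed.

Lemma Borel_preimage_affine k (M : 'M[R]_(k, m)) (c : 'M[R]_(k, n)) S :
  Borel S -> Borel [set x : 'M[R]_(m, n) | S (M *m x + c)].
Proof.
move=> bS; have := random_mxD (random_mx_mulmx M random_mx_id) (random_mx_cst c).
exact.
Qed.

Lemma BorelI (S S' : set 'M[R]_(m, n)) : Borel S -> Borel S' -> Borel (S `&` S').
Proof. by move=> bS bS'; exact: (@measurableI _ borelT). Qed.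

End borel_preimage.

Lemma Borel_linear_form {R : realType} {n : nat} (b : 'rV[R]_n) (B : set R) :
  measurable B -> Borel [set x : 'cV[R]_n | B ((b *m x) ord0 ord0)].
Proof.
move=> mB; have mf := random_mx_mulmx_entry b (@random_mx_id R n 1).
rewrite -[X in Borel X]setTI; exact: (mf measurableT _ mB).
Qed.

Lemma mxlin_col {R : realType} {n : nat} (a x : 'cV[R]_n) :
  mxlin a x = (a^T *m x) ord0 ord0.
Proof. by rewrite /mxlin mxE; apply: eq_bigr => i _; rewrite big_ord1 mxE. Qed.

Lemma state_proc0 {R : realType} {Om : Type} {n m l : nat} (A : 'M[R]_n)
    (B : 'M[R]_(n, m)) (G : 'M[R]_(n, l)) w x0 u (om : Om) :
  state_proc A B G w x0 u 0 om = x0.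
Proof. by rewrite /state_proc big_ord0 addr0 expr0 mul1mx. Qed.

Lemma state_procS {R : realType} {Om : Type} {n m l : nat} (A : 'M[R]_n)
    (B : 'M[R]_(n, m)) (G : 'M[R]_(n, l)) w x0 u t (om : Om) :
  state_proc A B G w x0 u t.+1 om =
  A *m state_proc A B G w x0 u t om + (B *m u t + G *m w t om).
Proof.
rewrite /state_proc big_ord_recr /= subn1 /= subnn expr0 mul1mx addrA; congr (_ + _).
rewrite exprS -mulmxA mulmxDr mulmx_sumr; congr (_ + _).
apply: eq_bigr => i _; rewrite mulmxA -[A *m A ^+ _]/(A * A ^+ _) -exprS; congr (_ ^+ _ *m _).
by rewrite (subnAC t) (subn1 (t - i)) prednK ?subn_gt0 ?ltn_ord// subn1.
Qed.

Section noise.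
Context {R : realType} {d : measure_display} {Om : measurableType d}.
Context {P : probability Om R} {l p : nat} {mu : 'cV[R]_l} {Psi : 'M[R]_p}.
Context {w : nat -> Om -> 'cV[R]_l} {nu : nat -> Om -> 'cV[R]_p}.
Hypothesis H : noise_model P mu Psi w nu.

Lemma noise_random_w t : random_mx (w t).
Proof. by case: H => h _; exact: h. Qed.

Lemma noise_random_nu t : random_mx (nu t).
Proof. by case: H => _ [h _]; exact: h. Qed.

Lemma mulmx_tr_ge0 k (b : 'rV[R]_k) : 0 <= (b *m b^T) ord0 ord0.
Proof. by rewrite mxE sumr_ge0// => i _; rewrite mxE -expr2 sqr_ge0. Qed.

Lemma noise_cov_ge0 (c : 'rV[R]_p) : 0 <= (c *m Psi *m c^T) ord0 ord0.
Proof.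
case: H => _ [_ [_ [/(_ 0%N) [_ [psd _]] _]]].
by have := psd c^T; rewrite trmxK.
Qed.

Lemma noise_law_w t (b : 'rV[R]_l) (B : set R) : measurable B ->
  P [set om | B ((b *m w t om) ord0 ord0)] =
  gauss_law ((b *m mu) ord0 ord0) ((b *m b^T) ord0 ord0) B.
Proof.
case: H => _ [_ [/(_ t) [_ [_ h]] _]] mB.
by have := h b^T B mB; rewrite trmxK mulmx1.
Qed.

Lemma noise_law_nu t (c : 'rV[R]_p) (B : set R) : measurable B ->
  P [set om | B ((c *m nu t om) ord0 ord0)] =
  gauss_law 0 ((c *m Psi *m c^T) ord0 ord0) B.
Proof.
case: H => _ [_ [_ [/(_ t) [_ [_ h]] _]]] mB.
by have := h c^T B mB; rewrite trmxK mulmx0 mxE.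
Qed.

Lemma noise_law_affine T (k : R) (b : nat -> 'rV[R]_l) (c : nat -> 'rV[R]_p)
    (B : set R) : measurable B ->
  P [set om | B (k + (\sum_(i < T) (b i *m w i om) ord0 ord0 +
                      \sum_(i < T) (c i *m nu i om) ord0 ord0))] =
  gauss_law (k + \sum_(i < T) (b i *m mu) ord0 ord0)
    (\sum_(i < T) (b i *m (b i)^T) ord0 ord0 +
     \sum_(i < T) (c i *m Psi *m (c i)^T) ord0 ord0) B.
Proof.
(* Lists the [T] functionals of [w] and then the [T] functionals of [nu] as one sequence of [2T]
   independent scalars. *)
pose sel (U : Type) (f g : nat -> U) i := if (i < T)%N then f i else g (i - T)%N.
have selE (f g : nat -> R) :
    \sum_(i < T + T) sel R f g i = \sum_(i < T) f i + \sum_(i < T) g i.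
  rewrite big_split_ord /=; congr (_ + _); apply: eq_bigr => i _; rewrite /sel.
    by rewrite ltn_ord.
  by rewrite ltnNge leq_addr/= addKn.
pose xi i om := sel R (fun i => (b i *m w i om) ord0 ord0)
  (fun i => (c i *m nu i om) ord0 ord0) i.
have Em : \sum_(i < T) (b i *m mu) ord0 ord0 =
    \sum_(i < T + T) sel R (fun i => (b i *m mu) ord0 ord0) (fun=> 0) i.
  by rewrite selE big1_eq addr0.
have Ex om : \sum_(i < T) (b i *m w i om) ord0 ord0 +
    \sum_(i < T) (c i *m nu i om) ord0 ord0 = \sum_(i < T + T) xi i om.
  by rewrite /xi selE.
under eq_set do rewrite Ex.
rewrite Em -(selE (fun i => (b i *m (b i)^T) ord0 ord0)
  (fun i => (c i *m Psi *m (c i)^T) ord0 ord0)).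
move: B; apply: gauss_law_sum.
- move=> i; rewrite /xi /sel; case: (i < T)%N.
    by apply: random_mx_mulmx_entry; exact: noise_random_w.
  by apply: random_mx_mulmx_entry; exact: noise_random_nu.
- by move=> i; rewrite /sel; case: ifP => _; [exact: mulmx_tr_ge0|exact: noise_cov_ge0].
- move=> i B mB; rewrite /xi /sel; case: (i < T)%N; first exact: noise_law_w.
  exact: noise_law_nu.
move=> C mC; case: H => _ [_ [_ [_ ind]]].
have := ind (iota 0 T) (iota 0 T) (fun t => [set x | C t ((b t *m x) ord0 ord0)])
  (fun s => [set x | C (T + s)%N ((c s *m x) ord0 ord0)]) (iota_uniq _ _) (iota_uniq _ _).
move=> /(_ (fun t => Borel_linear_form (b t) (mC t))
           (fun s => Borel_linear_form (c s) (mC _))).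
have -> : [set om | (forall t, t \in iota 0 T -> C t ((b t *m w t om) ord0 ord0)) /\
    (forall s, s \in iota 0 T -> C (T + s)%N ((c s *m nu s om) ord0 ord0))] =
  [set om | forall i, (i < T + T)%N -> C i (xi i om)].
  apply/seteqP; split => om /=.
    move=> [h1 h2] i iT; rewrite /xi /sel; case: ltnP => Ti.
      by apply: h1; rewrite mem_iota.
    rewrite -{1}(subnKC Ti); apply: h2.
    by rewrite mem_iota add0n /= ltn_subLR.
  move=> h; split => i; rewrite mem_iota add0n /= => iT.
    by have := h i (ltn_addr _ iT); rewrite /xi /sel iT.
  have := h (T + i)%N; rewrite ltn_add2l iT => /(_ isT).
  by rewrite /xi /sel ltnNge leq_addr/= addKn.
move=> ->; rewrite (big_cat_nat (leq0n T) (leq_addr T T)) /=; congr (_ * _)%E.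
  rewrite /index_iota subn0; apply: eq_big_seq => i; rewrite mem_iota add0n /= => iT.
  by rewrite /xi /sel iT.
rewrite -{3}(add0n T) big_addn addnK /index_iota subn0.
apply: eq_big_seq => i; rewrite mem_iota add0n /= => iT.
by rewrite /xi /sel ltnNge leq_addl/= addnK [(i + T)%N]addnC.
Qed.

(* [w t] has the law of the vector [w j om j] on the diagonal, whose entries are
   independent. *)
Lemma noise_ball_gt0 t (z : 'cV[R]_l) (e : R) : 0 < e ->
  (0 < P [set om | ball z e (w t om)])%E.
Proof.
move=> e0; pose Z om : 'cV[R]_l := \col_j w j om j ord0.
have rZ : random_mx Z.
  apply/random_mxP => i j; rewrite (_ : (fun om => _) = (fun om => w i om i ord0)).
    by have /random_mxP := noise_random_w i; exact.
  by apply/funext => om; rewrite mxE.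
have dE (j : 'I_l) (y : 'cV[R]_l) : ((delta_mx ord0 j : 'rV_l) *m y) ord0 ord0 = y j ord0.
  by rewrite -rowE mxE.
have -> : P [set om | ball z e (w t om)] = P [set om | ball z e (Z om)].
  apply: (@cramer_wold _ _ _ _ _ _ _ P P (w t) Z (noise_random_w t) rZ _ (ball z e)).
    move=> a B mB.
    (* The functional of [w i] reads only coordinate [i], weighted by [a]. The variances add up to
       [a^T a], as for [a] applied to [w t]. Indices beyond [l] get 0. *)
    pose b (i : nat) : 'rV[R]_l :=
      if insub i is Some j then a j ord0 *: delta_mx ord0 (j : 'I_l) else 0.
    have bE (j : 'I_l) : b j = a j ord0 *: delta_mx ord0 j by rewrite /b valK.
    have bw (j : 'I_l) (y : 'cV[R]_l) : (b j *m y) ord0 ord0 = a j ord0 * y j ord0.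
      by rewrite bE -scalemxAl mxE dE.
    have E1 om : mxlin a (w t om) = (a^T *m w t om) ord0 ord0 by rewrite mxlin_col.
    under eq_set do rewrite E1.
    rewrite noise_law_w// trmxK.
    have E2 om : mxlin a (Z om) = 0 + (\sum_(i < l) (b i *m w i om) ord0 ord0 +
        \sum_(i < l) ((0 : 'rV_p) *m nu i om) ord0 ord0).
      rewrite add0r [X in _ = _ + X]big1; last by move=> i _; rewrite mul0mx mxE.
      rewrite addr0 mxlin_col mxE; apply: eq_bigr => i _.
      by rewrite bw !mxE.
    under [in RHS]eq_set do rewrite E2.
    apply: (etrans _ (esym (noise_law_affine l 0 b (fun=> 0) mB))).
    have -> : 0 + \sum_(i < l) (b i *m mu) ord0 ord0 = (a^T *m mu) ord0 ord0.
      by rewrite add0r [RHS]mxE; apply: eq_bigr => i _; rewrite bw mxE.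
    have -> : \sum_(i < l) (b i *m (b i)^T) ord0 ord0 +
        \sum_(i < l) ((0 : 'rV_p) *m Psi *m (0 : 'rV_p)^T) ord0 ord0 = (a^T *m a) ord0 ord0.
      rewrite addrC big1 ?add0r; last by move=> i _; rewrite !mul0mx mxE.
      rewrite [RHS]mxE; apply: eq_bigr => i _.
      by rewrite bw mxE bE !mxE !eqxx mulr1.
    by [].
  by apply: Borel_open; exact: ball_open.
(* Coordinate [i] of [Z] comes from time [i], so independence in time factors the ball into
   intervals. Indices beyond [l] get the trivial constraint. *)
pose A (i : nat) : set 'cV[R]_l :=
  if insub i is Some j then [set x | `]z (j : 'I_l) ord0 - e, z j ord0 + e[%classic
    (((delta_mx ord0 j : 'rV_l) *m x) ord0 ord0)] else setT.
have bA i : Borel (A i).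
  rewrite /A; case: insub => [j|]; first exact: Borel_linear_form.
  by apply: Borel_open; exact: openT.
case: (H) => _ [_ [_ [_ ind]]].
have := ind (iota 0 l) [::] A (fun=> setT) (iota_uniq _ _) isT bA
  (fun=> Borel_open openT).
rewrite big_nil mule1.
have -> : [set om | (forall t, t \in iota 0 l -> A t (w t om)) /\
    (forall s, s \in [::] -> [set: 'cV[R]_p] (nu s om))] = [set om | ball z e (Z om)].
  apply/seteqP; split => om /=.
    move=> [h _]; split => // i j; rewrite ord1 mxE.
    have := h i; rewrite mem_iota /= ltn_ord => /(_ isT).
    by rewrite /A valK /= dE in_itv/= /ball/= ltr_norml => /andP[h1 h2]; lra.
  move=> [_ h]; split => // i; rewrite mem_iota /= add0n => il.
  have := h (Ordinal il) ord0; rewrite mxE /ball/= ltr_norml /A insubT /= dE in_itv/=.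
  by move=> /andP[h1 h2]; lra.
move=> ->; rewrite big_seq; apply: (big_ind (fun x => 0 < x)%E) => //.
  by move=> x y; exact: mule_gt0.
move=> i; rewrite mem_iota /= add0n => il; pose j := Ordinal il.
have -> : [set om | A i (w i om)] = [set om | `]z j ord0 - e, z j ord0 + e[%classic
    (((delta_mx ord0 j : 'rV_l) *m w i om) ord0 ord0)] by rewrite /A insubT.
rewrite (noise_law_w i (delta_mx ord0 j) (measurable_itv `]z j ord0 - e, z j ord0 + e[)).
apply: gauss_law_itvoo_gt0; last by lra.
by rewrite dE !mxE !eqxx ltr01.
Qed.

End noise.

(** * Affine subspaces and the support of the state *)

Section affine_image.
Context {R : realType} {n k : nat}.
Implicit Types (M : 'M[R]_(n, k)) (c : 'cV[R]_n).

Definition affine_image c M : set 'cV[R]_n := [set x | exists z, x = c + M *m z].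

(** The image of [M] is the kernel of a matrix [Q], so the affine space is the common zero set of
    finitely many continuous functions. *)
Lemma closed_affine_image c M : closed (affine_image c M).
Proof.
pose Q := (cokermx M^T)^T.
have QM : Q *m M = 0 by apply: trmx_inj; rewrite trmx_mul trmxK mulmx_coker trmx0.
have -> : affine_image c M = \bigcap_(i : 'I_n) [set x | (Q *m (x - c)) i ord0 = 0].
  apply/seteqP; split => [x [z ->] i _ /=|x h].
    by rewrite addrAC subrr add0r mulmxA QM mul0mx mxE.
  have /submxP[z zE] : ((x - c)^T <= M^T)%MS.
    rewrite submxE -[_ *m _]trmxK trmx_mul trmxK; apply/eqP.
    rewrite (_ : _ *m _ = 0) ?trmx0//; apply/matrixP => i j.
    by rewrite (ord1 j) [RHS]mxE; exact: h.
  exists z^T; apply/eqP; rewrite addrC -subr_eq; apply/eqP.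
  by rewrite -[LHS]trmxK zE trmx_mul trmxK.
apply: closed_bigI => i _.
have cf : continuous (fun x : 'cV[R]_n => (Q *m (x - c)) i ord0).
  rewrite (_ : (fun x => _) =
    (fun x : 'cV[R]_n => \sum_j Q i j * (x j ord0 - c j ord0))); last first.
    by apply/funext => y; rewrite mxE; apply: eq_bigr => j _; rewrite !mxE.
  apply: continuous_big => [|j _]; first exact: add_continuous.
  move=> x; apply: (@continuous_comp _ _ _ (fun x : 'cV[R]_n => x j ord0)
    (fun y : R => Q i j * (y - c j ord0))); first exact: coord_continuous.
  apply: cvgM; first exact: cvg_cst.
  by apply: cvgB; [exact: cvg_id|exact: cvg_cst].
apply: (@closed_comp _ _ _ [set 0]) => [x _|]; first exact: cf.
exact: closed_eq.
Qed.

Lemma Borel_affine_image c M : Borel (affine_image c M).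
Proof. by apply: Borel_closed; exact: closed_affine_image. Qed.

End affine_image.

Section mulmx_ball.
Context {R : realType}.

Lemma mulmx_ball n k (M : 'M[R]_(n, k)) (r : R) : 0 < r ->
  exists2 e : R, 0 < e &
    forall y y' : 'cV[R]_k, ball y e y' -> ball (M *m y) r (M *m y').
Proof.
(* [S] dominates every absolute row sum; the added 1 keeps the denominator positive and the final
   inequality strict. *)
move=> r0; pose S := \sum_i \sum_j `|M i j|.
have S0 : 0 <= S by apply: sumr_ge0 => i _; apply: sumr_ge0.
have e0 : 0 < r / (1 + S) by rewrite divr_gt0// ltr_pwDl.
exists (r / (1 + S)) => // y y' [_ yy']; split => // i j; rewrite (ord1 j) /ball/=.
rewrite !mxE -sumrB; apply: (le_lt_trans (ler_norm_sum _ _ _)).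
apply: (@le_lt_trans _ _ (S * (r / (1 + S)))).
  apply: (@le_trans _ _ (\sum_j `|M i j| * (r / (1 + S)))).
    apply: ler_sum => l _; rewrite -mulrBr normrM ler_wpM2l//.
    by have /ltW := yy' l ord0.
  rewrite -mulr_suml; apply: ler_wpM2r; first exact: ltW.
  rewrite /S [leRHS](bigD1 i)//= lerDl; apply: sumr_ge0 => l _; exact: sumr_ge0.
by rewrite mulrA ltr_pdivrMr ?ltr_pwDl//; lra.
Qed.

Lemma addmx_ball n (a a' b b' : 'cV[R]_n) (r : R) :
  ball a (r / 2) a' -> ball b (r / 2) b' -> ball (a + b) r (a' + b').
Proof.
move=> [r0 aa] [_ bb]; split=> [|i j]; first by lra.
rewrite /ball/= !mxE opprD addrACA (le_lt_trans (ler_normD _ _))//.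
have := aa i j; have := bb i j; rewrite /ball/=; lra.
Qed.

End mulmx_ball.

Section support.
Context {R : realType} {n m l : nat}.
Variables (A : 'M[R]_n) (B : 'M[R]_(n, m)) (G : 'M[R]_(n, l)).
Variables (x0 : 'cV[R]_n) (u : nat -> 'cV[R]_m).

(** The noise trajectory itself serves as the sample point, so facts on [state_proc] apply to
    deterministic paths. *)
Definition state_path (t : nat) (z : nat -> 'cV[R]_l) : 'cV[R]_n :=
  state_proc A B G (fun t z => z t) x0 u t z.

Lemma state_path_ext t (z z' : nat -> 'cV[R]_l) :
  (forall i, (i < t)%N -> z i = z' i) -> state_path t z = state_path t z'.
Proof.
move=> zz'; rewrite /state_path /state_proc; congr (_ + _).
by apply: eq_bigr => i _; rewrite zz'.
Qed.

(** The newest noise value multiplies [G], the first block of [reach_aux], while older values are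
    propagated by [A], like the remaining blocks. *)
Lemma range_state_path t :
  range (state_path t) = affine_image (state_path t (fun=> 0)) (reach_aux A G t).
Proof.
have pS s z : state_path s.+1 z = A *m state_path s z + (B *m u s + G *m z s).
  exact: state_procS.
have p0 z : state_path 0 z = x0 by exact: state_proc0.
elim: t => [|t ih].
  apply/seteqP; split => [_ [z _ <-]|_ [z ->]].
    by exists 0; rewrite !p0 mulmx0 addr0.
  by exists (fun=> 0) => //; rewrite mul0mx addr0.
have cS (a : 'cV[R]_l) (v : 'cV[R]_(t * l)) :
    state_path t.+1 (fun=> 0) + reach_aux A G t.+1 *m (col_mx a v : 'cV_(t.+1 * l)) =
    A *m (state_path t (fun=> 0) + reach_aux A G t *m v) + (B *m u t + G *m a).
  rewrite [reach_aux _ _ _]/= mul_row_col pS mulmx0 addr0.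
  rewrite [in RHS]mulmxDr [in RHS](mulmxA A (reach_aux A G t)).
  by rewrite [G *m a + _]addrC addrACA.
apply/seteqP; split => [_ [z _ <-]|_ [v ->]].
  have [v vE] : affine_image (state_path t (fun=> 0)) (reach_aux A G t) (state_path t z).
    by rewrite -ih; exists z.
  by exists (col_mx (z t) v); rewrite cS -vE pS.
rewrite -[v](@vsubmxK _ l (t * l)) cS.
have [z _ zE] : range (state_path t)
    (state_path t (fun=> 0) + reach_aux A G t *m @dsubmx _ l (t * l) _ v).
  by rewrite ih; eexists.
(* The state at time [t] ignores the noise at time [t], so the top block can be put there freely. *)
exists (fun i => if (i < t)%N then z i else @usubmx _ l (t * l) _ v) => //.
rewrite pS ltnn -zE; congr (_ *m _ + _); apply: state_path_ext => i it.
by rewrite it.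
Qed.

Lemma state_path_ball t (r : R) : 0 < r -> exists2 e : R, 0 < e &
  forall z z', (forall i, (i < t)%N -> ball (z i) e (z' i)) ->
    ball (state_path t z) r (state_path t z').
Proof.
have pS s z : state_path s.+1 z = A *m state_path s z + (B *m u s + G *m z s).
  exact: state_procS.
elim: t r => [|t ih] r r0.
  exists 1 => // z z' _; rewrite /state_path !state_proc0; exact: ballxx.
have r20 : 0 < r / 2 by rewrite divr_gt0.
have r40 : 0 < r / 2 / 2 by rewrite divr_gt0.
have [e1 e10 he1] := mulmx_ball A r20.
have [e2 e20 he2] := ih _ e10.
have [e3 e30 he3] := mulmx_ball G r40.
exists (Num.min e2 e3); first by rewrite lt_min e20.
move=> z z' zz'; rewrite !pS; apply: addmx_ball.
  apply: he1; apply: he2 => i it; apply: le_ball (zz' i _); last exact: ltnW.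
  by rewrite ge_min lexx.
apply: addmx_ball; first exact: ballxx.
by apply: he3; apply: le_ball (zz' t _) => //; rewrite ge_min lexx orbT.
Qed.

Context {d : measure_display} {Om : measurableType d} {p : nat}.
Variables (P : probability Om R) (mu : 'cV[R]_l) (Psi : 'M[R]_p).
Variables (w : nat -> Om -> 'cV[R]_l) (nu : nat -> Om -> 'cV[R]_p).
Hypothesis H : noise_model P mu Psi w nu.

Lemma random_state t : random_mx (state_proc A B G w x0 u t).
Proof.
elim: t => [|t ih].
  rewrite (_ : state_proc _ _ _ _ _ _ _ = fun=> x0); first exact: random_mx_cst.
  by apply/funext => om; rewrite state_proc0.
rewrite (_ : state_proc _ _ _ _ _ _ _ = fun om => A *m state_proc A B G w x0 u t om +
  (B *m u t + G *m w t om)).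
  apply: random_mxD; first exact: random_mx_mulmx.
  apply: random_mxD; first exact: random_mx_cst.
  by apply: random_mx_mulmx; exact: (noise_random_w H).
by apply/funext => om; rewrite state_procS.
Qed.

Lemma state_procE t om : state_proc A B G w x0 u t om = state_path t (w ^~ om).
Proof. by []. Qed.

(** Every trajectory stays in the affine space, which is closed, so points outside have a ball of
    probability 0. Conversely, a point of it is reached by some noise path; by independence the
    noise stays close to that path for [t] steps with positive probability, and then the state is
    close to the point. *)
Lemma supp_state t : supp P (state_proc A B G w x0 u t) =
  affine_image (state_path t (fun=> 0)) (reach_aux A G t).
Proof.
have bo (x : 'cV[R]_n) r : Borel (ball x r) by apply: Borel_open; exact: ball_open.
apply/seteqP; split => [x xs|x].
  apply: contrapT => xV.
  have : open (~` affine_image (state_path t (fun=> 0)) (reach_aux A G t)).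
    by apply: closed_openC; exact: closed_affine_image.
  rewrite openE => /(_ x xV) /nbhs_ballP[r /= r0 rV].
  have := xs r r0; rewrite (_ : [set om | _] = set0) ?measure0 ?ltxx//.
  apply/seteqP; split => om //= /rV; apply; rewrite -range_state_path state_procE.
  by exists (w ^~ om).
rewrite -range_state_path => -[z _ <-] r r0.
have [e e0 he] := state_path_ball t r0.
case: (H) => _ [_ [_ [_ ind]]].
have := ind (iota 0 t) [::] (fun i => ball (z i) e) (fun=> setT) (iota_uniq _ _) isT.
move=> /(_ (fun i => Borel_open (ball_open (z i) e)) (fun=> Borel_open openT)).
rewrite big_nil mule1 => E.
have : (0 < P [set om | (forall i, i \in iota 0 t -> ball (z i) e (w i om)) /\
   (forall s, s \in [::] -> [set: 'cV[R]_p] (nu s om))])%E.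
  rewrite E; apply: (big_ind (fun x => 0 < x)%E) => //.
    by move=> a b; exact: mule_gt0.
  by move=> i _; exact: (noise_ball_gt0 H).
move=> /lt_le_trans; apply; apply: le_measure; rewrite ?inE.
- rewrite (_ : [set om | _] = \bigcap_(i in [set i | i \in iota 0 t]) (w i @^-1` ball (z i) e)).
    apply: bigcap_measurableType => i _; apply: (noise_random_w H).
    by apply: Borel_open; exact: ball_open.
  apply/seteqP; split => om /=; first by case=> h _ i; exact: h.
  by move=> h; split => // i; exact: h.
- exact: random_state.
- move=> om /= [h _]; rewrite state_procE; apply: he => i it.
  by apply: h; rewrite mem_iota.
Qed.

(** The second clause holds for every outcome and not merely almost surely, so no null sets have to
    be discarded later. *)
Lemma supp_state_affine t : exists2 c,
  supp P (state_proc A B G w x0 u t) = affine_image c (reach_aux A G t) &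
  forall om, affine_image c (reach_aux A G t) (state_proc A B G w x0 u t om).
Proof.
exists (state_path t (fun=> 0)); first exact: supp_state.
by move=> om; rewrite -range_state_path state_procE; exists (w ^~ om).
Qed.

End support.

(** * Linear algebra *)

Section linear_algebra.
Context {R : realType}.

(** The columns of [cokermx N] span the kernel of [N]; that [M] kills them means that the row space
    of [M] lies in that of [N]. *)
Lemma mulmx_factor a b n (M : 'M[R]_(a, n)) (N : 'M[R]_(b, n)) :
  (forall x : 'cV[R]_n, N *m x = 0 -> M *m x = 0) -> exists K, M = K *m N.
Proof.
move=> MN; apply/submxP; rewrite submxE; apply/eqP/matrixP => i j.
have /MN : N *m (cokermx N *m delta_mx j ord0 : 'cV_n) = 0.
  by rewrite mulmxA mulmx_coker mul0mx.
by rewrite mulmxA -colE => /matrixP /(_ i ord0); rewrite !mxE.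
Qed.

Lemma reach_auxP n l (A : 'M[R]_n) (G : 'M[R]_(n, l)) k (v : 'cV[R]_n) :
  (exists z, v = reach_aux A G k *m z) <->
  exists f : nat -> 'cV[R]_l, v = \sum_(i < k) A ^+ i *m (G *m f i).
Proof.
have shift (f : nat -> 'cV[R]_l) k' : \sum_(i < k'.+1) A ^+ i *m (G *m f i) =
    G *m f 0%N + A *m \sum_(i < k') A ^+ i *m (G *m f i.+1).
  rewrite big_ord_recl expr0 mul1mx mulmx_sumr; congr (_ + _).
  by apply: eq_bigr => i _; rewrite [RHS]mulmxA -[A *m A ^+ _]/(A * A ^+ _) -exprS.
elim: k v => [|k ih] v.
  split=> [[z ->]|[f ->]]; first by exists (fun=> 0); rewrite big_ord0 mul0mx.
  by exists 0; rewrite big_ord0 mulmx0.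
split=> [[z ->]|[f ->]].
  rewrite -[z](@vsubmxK _ l (k * l)) [reach_aux _ _ _]/= mul_row_col -mulmxA.
  have [f ->] : exists f : nat -> 'cV[R]_l, reach_aux A G k *m @dsubmx _ l (k * l) _ z =
      \sum_(i < k) A ^+ i *m (G *m f i) by apply/ih; eexists.
  pose g i := if i is i'.+1 then f i' else @usubmx _ l (k * l) _ z.
  by exists g; rewrite (shift g).
rewrite (shift f).
have [z ->] : exists z, \sum_(i < k) A ^+ i *m (G *m f i.+1) = reach_aux A G k *m z.
  by apply/ih; exists (fun i => f i.+1).
by exists (col_mx (f 0%N) z); rewrite [reach_aux _ _ _]/= mul_row_col mulmxA.
Qed.

(* Cayley-Hamilton: [A ^+ i] is a combination of the powers below [n]. *)
Lemma reach_aux_sub n l (A : 'M[R]_n) (G : 'M[R]_(n, l)) k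
    (z : 'cV[R]_(k * l)) :
  exists z', reach_aux A G k *m z = Reach A G *m z'.
Proof.
apply/reach_auxP.
have [f ->] : exists f : nat -> 'cV[R]_l, reach_aux A G k *m z =
    \sum_(i < k) A ^+ i *m (G *m f i) by apply/reach_auxP; exists z.
move: z => _; case: n => [|n] in A G *.
  by exists (fun=> 0); apply/matrixP => -[].
have pow i (y : 'cV[R]_l) : exists g : nat -> 'cV[R]_l,
    A ^+ i *m (G *m y) = \sum_(j < n.+1) A ^+ j *m (G *m g j).
  (* The remainder has degree at most [n] and, by Cayley-Hamilton, the same value at [A] as the
     monomial. *)
  pose q : {poly R} := 'X^i %% char_poly A.
  have szq : (size q <= n.+1)%N.
    rewrite -ltnS -(size_char_poly A) ltn_modp -size_poly_eq0 size_char_poly//.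
  have Aq : A ^+ i = \sum_(j < n.+1) q`_j *: A ^+ j.
    transitivity (horner_mx A q).
      rewrite -{1}(horner_mx_X A) -rmorphXn /= [in LHS](divp_eq 'X^i (char_poly A)).
      by rewrite rmorphD rmorphM /= Cayley_Hamilton mulr0 add0r.
    rewrite {1}(_ : q = \poly_(j < n.+1) q`_j); last first.
      apply/polyP => j; rewrite coef_poly; case: ltnP => // nj.
      by rewrite nth_default// (leq_trans szq).
    rewrite poly_def linear_sum; apply: eq_bigr => j _.
    by rewrite linearZ rmorphXn /= horner_mx_X.
  exists (fun j => q`_j *: y); rewrite Aq mulmx_suml; apply: eq_bigr => j _.
  by rewrite -scalemxAl -!scalemxAr.
elim: k => [|k [g ih]].
  exists (fun=> 0); rewrite big_ord0 big1// => i _; by rewrite !mulmx0.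
have [g' g'E] := pow k (f k); exists (fun j => g j + g' j).
rewrite big_ord_recr /= ih g'E -big_split; apply: eq_bigr => j _.
by rewrite !mulmxDr.
Qed.

(** Polarization: evaluating the difference at a sum of two basis vectors isolates twice an
    off-diagonal entry. *)
Lemma quad_form_inj r (S1 S2 : 'M[R]_r) : S1^T = S1 -> S2^T = S2 ->
  (forall b : 'rV[R]_r, (b *m S1 *m b^T) ord0 ord0 = (b *m S2 *m b^T) ord0 ord0) ->
  S1 = S2.
Proof.
move=> s1 s2 h; apply/subr0_eq.
set D := S1 - S2.
have sD i j : D i j = D j i.
  by rewrite -[D in LHS]trmxK mxE /D linearB /= s1 s2.
have q (b : 'rV[R]_r) : (b *m D *m b^T) ord0 ord0 = 0.
  by rewrite /D mulmxBr mulmxBl mxE [X in _ + X]mxE h subrr.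
rewrite -/D; move: D sD q => D sD q.
have dD i j : ((delta_mx ord0 i : 'rV_r) *m D *m (delta_mx ord0 j : 'rV_r)^T) ord0 ord0 = D i j.
  by rewrite -rowE trmx_delta -colE !mxE.
apply/matrixP => i j; rewrite [RHS]mxE.
have := q (delta_mx ord0 i + delta_mx ord0 j).
rewrite [(_ + _)^T]linearD /= !mulmxDl !mulmxDr.
have aE (X Y : 'M[R]_1) : (X + Y) ord0 ord0 = X ord0 ord0 + Y ord0 ord0 by rewrite mxE.
rewrite !aE !dD.
have := q (delta_mx ord0 i); have := q (delta_mx ord0 j); rewrite !dD => -> ->.
by rewrite (sD j i) add0r addr0; lra.
Qed.

Lemma rowV_inj r (x y : 'cV[R]_r) :
  (forall b : 'rV[R]_r, (b *m x) ord0 ord0 = (b *m y) ord0 ord0) -> x = y.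
Proof.
move=> h; apply/matrixP => i j; have := h (delta_mx ord0 i).
by rewrite -!rowE !mxE (ord1 j).
Qed.

Lemma colV_inj a n (M N : 'M[R]_(a, n)) :
  (forall x : 'cV[R]_n, M *m x = N *m x) -> M = N.
Proof.
move=> h; apply/matrixP => i j; have := h (delta_mx j ord0).
by rewrite -!colE => /matrixP /(_ i ord0); rewrite !mxE.
Qed.

Lemma ker_pairP r n1 n2 (M1 : 'M[R]_(r, n1)) (M2 : 'M[R]_(r, n2)) x1 x2 :
  ker_pair M1 M2 (x1, x2) <-> M1 *m x1 = M2 *m x2.
Proof.
rewrite /ker_pair /= mul_row_col mulNmx; split; first exact: subr0_eq.
by move=> ->; rewrite subrr.
Qed.

End linear_algebra.

(** * Bisimulation *)

Section transfer.
Context {R : realType} {d1 d2 : measure_display}.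
Context {Om1 : measurableType d1} {Om2 : measurableType d2} {n m l p r : nat}.
Variables (P1 : probability Om1 R) (P2 : probability Om2 R).
Variables (A : 'M[R]_n) (B : 'M[R]_(n, m)) (G : 'M[R]_(n, l)).
Variables (mu : 'cV[R]_l) (Psi : 'M[R]_p).
Variables (w : nat -> Om1 -> 'cV[R]_l) (nu : nat -> Om1 -> 'cV[R]_p).
Hypothesis H : noise_model P1 mu Psi w nu.
Variables (R1 : 'M[R]_(r, n)) (x0 : 'cV[R]_n) (u : nat -> 'cV[R]_m) (t : nat).
Variable Y : Om2 -> 'cV[R]_r.
Hypothesis mY : random_mx Y.

Local Notation x := (state_proc A B G w x0 u t).
Local Notation M := (reach_aux A G t).

(* Conditions (i) and (ii) of a bisimulation, with [Y] the image of the other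
   state under its matrix. *)
Definition transfer_cond := forall X : set 'cV[R]_n, Borel X ->
  P1 [set om | X (x om)] =
  P2 [set om | exists2 y, (X `&` supp P1 x) y & R1 *m y = Y om].

(** On the support [y] is recovered from [R1 y] by an affine map. Hence the existence of a support
    point of [X] above [Y] says that [Y] lies in an explicit Borel set [S], and equality of the
    projected laws can be applied. *)
Lemma transfer_law : (forall v : 'cV[R]_n, (exists z, v = Reach A G *m z) ->
    R1 *m v = 0 -> v = 0) ->
  (forall S, Borel S -> P1 [set om | S (R1 *m x om)] = P2 [set om | S (Y om)]) ->
  transfer_cond.
Proof.
move=> h5 law X bX; have [c -> xV] := supp_state_affine A B G x0 u H t.
(* (h5) says that [R1 *m M] has no larger kernel than [M], so [M] factors through it; [K] inverts
   [R1] on the image of [M]. *)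
have [K KE] : exists K, M = K *m (R1 *m M).
  apply: mulmx_factor => z; rewrite -mulmxA; apply: h5.
  exact: reach_aux_sub.
pose e := c - K *m (R1 *m c).
have LE y : affine_image c M y -> K *m (R1 *m y) + e = y.
  move=> [z ->]; rewrite !mulmxDr (mulmxA R1 M) (mulmxA K (R1 *m M)) -KE /e.
  by rewrite addrC addrA addrNK.
(* The last set uses that [affine_image 0 0] is the point 0: it expresses that [K *m z + e] lies
   above [z], as a preimage of a closed set. *)
pose S := [set z | X (K *m z + e)] `&` [set z | affine_image c M (K *m z + e)] `&`
  [set z | affine_image 0 (0 : 'M[R]_r) ((R1 *m K - 1%:M) *m z + R1 *m e)].
have bS : Borel S.
  apply: BorelI; first apply: BorelI.
  - exact: Borel_preimage_affine.
  - by apply: Borel_preimage_affine; exact: Borel_affine_image.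
  - by apply: Borel_preimage_affine; exact: Borel_affine_image.
have SE z : S z <-> [/\ X (K *m z + e), affine_image c M (K *m z + e) &
    R1 *m (K *m z + e) = z].
  have E : (R1 *m K - 1%:M) *m z + R1 *m e = R1 *m (K *m z + e) - z.
    by rewrite mulmxBl mul1mx mulmxDr mulmxA addrAC.
  split=> [[[h1 h2]] [y]|[h1 h2 h3]].
    by rewrite E mul0mx addr0 => /subr0_eq h3.
  split=> //; exists 0; rewrite -[LHS]/((R1 *m K - 1%:M) *m z + R1 *m e) E h3.
  by rewrite subrr mul0mx addr0.
have -> : [set om | X (x om)] = [set om | S (R1 *m x om)].
  apply/seteqP; split => om /=; last by move=> /SE[]; rewrite LE.
  by move=> Xx; apply/SE; rewrite LE.
rewrite law//; congr (P2 _); apply/seteqP; split => om /=.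
  by move=> /SE[h1 h2 h3]; exists (K *m Y om + e).
by move=> [y [Xy Vy] <-]; apply/SE; rewrite LE.
Qed.

Let transfer_image c X : supp P1 x = affine_image c M -> transfer_cond -> Borel X ->
  P1 [set om | X (x om)] = P2 [set om | exists2 y, (X `&` affine_image c M) y & R1 *m y = Y om].
Proof. by move=> <- tc bX; rewrite tc. Qed.

(** Testing with the whole space: the image of the support carries all the mass of [Y]. *)
Let transfer_full c : supp P1 x = affine_image c M -> transfer_cond ->
  P2 [set om | affine_image (R1 *m c) (R1 *m M) (Y om)] = 1%E.
Proof.
move=> sE tc; have := transfer_image sE tc (Borel_open openT).
rewrite (_ : [set om | setT (x om)] = setT) ?probability_setT; last exact/seteqP.
move=> ->; congr (P2 _); apply/seteqP; split => om /=.
  move=> [z zE]; exists (c + M *m z); first by split => //; exists z.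
  by rewrite mulmxDr mulmxA.
by move=> [_ [_ [z ->]] <-]; exists z; rewrite mulmxDr mulmxA.
Qed.

(** For a saturated set, the image of its part in the support is [S] cut by the image of the
    support. The latter has full measure by [transfer_full], so the cut changes nothing. *)
Lemma law_transfer : transfer_cond ->
  forall S, Borel S -> P1 [set om | S (R1 *m x om)] = P2 [set om | S (Y om)].
Proof.
move=> tc S bS; have [c sE _] := supp_state_affine A B G x0 u H t.
have bS' : Borel [set y : 'cV[R]_n | S (R1 *m y + 0)] by exact: Borel_preimage_affine.
have := transfer_image sE tc bS'.
rewrite (_ : [set om | _] = [set om | S (R1 *m x om)]); last first.
  by apply/seteqP; split => om; rewrite /= addr0.
move=> ->.
rewrite (_ : [set om | _] = [set om | S (Y om)] `&`
  [set om | affine_image (R1 *m c) (R1 *m M) (Y om)]); last first.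
  apply/seteqP; split => om /=.
    move=> [y [/= Sy [z yz]] E]; rewrite addr0 E in Sy; split=> //.
    by exists z; rewrite -E yz mulmxDr mulmxA.
  move=> [SY [z zE]]; have E : R1 *m (c + M *m z) = Y om by rewrite zE mulmxDr mulmxA.
  by exists (c + M *m z) => //; split; [rewrite /= addr0 E|exists z].
have mS : measurable [set om | S (Y om)] by exact: mY.
have mI : measurable [set om | affine_image (R1 *m c) (R1 *m M) (Y om)].
  by apply: mY; exact: Borel_affine_image.
have N0 : P2 (~` [set om | affine_image (R1 *m c) (R1 *m M) (Y om)]) = 0%E.
  by rewrite probability_setC// (transfer_full sE)// subee.
rewrite [RHS](measureDI P2 mS mI) [X in (X + _)%E](_ : _ = 0%E) ?add0e//.
apply/eqP; rewrite eq_le measure_ge0 andbT -N0; apply: le_measure.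
- by rewrite inE; exact: measurableD.
- by rewrite inE; exact: measurableC.
- by move=> om [].
Qed.

(* Were [v] in both subspaces, the open half-space of direction [v] through the
   mean would meet every fibre of [R1], yet its probability is below one. *)
Lemma transfer_reach_inj : transfer_cond -> forall v : 'cV[R]_n,
  (exists z, v = M *m z) -> R1 *m v = 0 -> v = 0.
Proof.
move=> tc v [zv vE] Rv; apply: contrapT => vn0.
have [c sE _] := supp_state_affine A B G x0 u H t.
have vv0 : 0 < (v^T *m v) ord0 ord0.
  rewrite lt_def; apply/andP; split; last first.
    by rewrite mxE sumr_ge0// => i _; rewrite mxE -expr2 sqr_ge0.
  apply/negP => /eqP h; apply: vn0; apply/matrixP => i j; rewrite (ord1 j) [RHS]mxE.
  apply/eqP; rewrite -sqrf_eq0 expr2; apply/eqP.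
  have /psumr_eq0P : \sum_i v i ord0 * v i ord0 = 0.
    by rewrite -[RHS]h mxE; apply: eq_bigr => k _; rewrite [X in _ = X * _]mxE.
  by apply => // k _; rewrite -expr2 sqr_ge0.
pose X := [set y : 'cV[R]_n | `](v^T *m c) ord0 ord0, +oo[%classic ((v^T *m y) ord0 ord0)].
have bX : Borel X by exact: Borel_linear_form.
have vD a b : (v^T *m (a + b)) ord0 ord0 = (v^T *m a) ord0 ord0 + (v^T *m b) ord0 ord0.
  by rewrite mulmxDr mxE.
have PX : P1 [set om | X (x om)] = 1%E.
  rewrite (transfer_image sE)// -(transfer_full sE)//; congr (P2 _); apply/seteqP; split => om /=.
    by move=> [_ [_ [z ->]] <-]; exists z; rewrite mulmxDr mulmxA.
  move=> [z zE].
  (* Moving along [v] does not change the value under [R1]; [k] is chosen so that the functional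
     [v^T] exceeds its value at [c] by exactly 1. *)
  pose k := (1 - (v^T *m (M *m z)) ord0 ord0) / (v^T *m v) ord0 ord0.
  exists (c + M *m (z + k *: zv)); last first.
    by rewrite !mulmxDr -!scalemxAr -vE Rv scaler0 addr0 zE mulmxA.
  split; last by exists (z + k *: zv).
  rewrite /X /= in_itv/= andbT mulmxDr -scalemxAr -vE !vD -scalemxAr [X in _ + (_ + X)]mxE.
  by rewrite /k divfK ?gt_eqF//; lra.
have mX : measurable [set om | X (x om)] by exact: (random_state A B G x0 u H).
have N0 : P1 (~` [set om | X (x om)]) = 0%E by rewrite probability_setC// PX subee.
(* The point [c - v] is in the support and lies at depth [v^T v] behind the hyperplane. A ball
   around it on which [v^T] varies by less than that misses [X]. *)
have [e e0 he] := mulmx_ball v^T vv0.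
have : (0 < P1 [set om | ball (c - v)%R e (x om)])%E.
  have : supp P1 x (c - v).
    rewrite sE; exists (- zv).
    by rewrite mulmxN -vE.
  exact.
rewrite ltNge => /negP; apply; rewrite -N0; apply: le_measure.
- by rewrite inE; apply: (random_state A B G x0 u H); apply: Borel_open; exact: ball_open.
- by rewrite inE; exact: measurableC.
move=> om /= /he [_ /(_ ord0 ord0)]; rewrite /X /= in_itv/= andbT => + h.
rewrite /ball/= ltr_norml vD mulmxN [X in _ + X - _]mxE => /andP[h1 _].
by move: h h1; lra.
Qed.

End transfer.

(** * Functionals of the two systems with common coefficients *)

Section matched.
Context {R : realType} {d1 d2 : measure_display}.
Context {Om1 : measurableType d1} {Om2 : measurableType d2} {l1 l2 p r : nat}.
Variables (P1 : probability Om1 R) (P2 : probability Om2 R).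
Variables (F1 : 'M[R]_(r, l1)) (F2 : 'M[R]_(r, l2)).
Variables (mu1 : 'cV[R]_l1) (mu2 : 'cV[R]_l2) (Psi : 'M[R]_p).
Variables (w1 : nat -> Om1 -> 'cV[R]_l1) (nu1 : nat -> Om1 -> 'cV[R]_p).
Variables (w2 : nat -> Om2 -> 'cV[R]_l2) (nu2 : nat -> Om2 -> 'cV[R]_p).

Definition noise_comb {l} {Om : Type} (F : 'M[R]_(r, l)) (w : nat -> Om -> 'cV[R]_l)
    (nu : nat -> Om -> 'cV[R]_p) T (k : R) (b : nat -> 'rV[R]_r)
    (c : nat -> 'rV[R]_p) (om : Om) : R :=
  k + (\sum_(i < T) (b i *m F *m w i om) ord0 ord0 +
       \sum_(i < T) (c i *m nu i om) ord0 ord0).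

(** The coefficients [k], [b], [c] are shared; only [F] and the noises differ. Unlike equality in
    law, this is preserved by sums, whatever the dependence between the summands. *)
Definition matched T (f1 : Om1 -> R) (f2 : Om2 -> R) := exists k b c,
  (forall om, f1 om = noise_comb F1 w1 nu1 T k b c om) /\
  (forall om, f2 om = noise_comb F2 w2 nu2 T k b c om).

Lemma matched_cst T k f1 f2 : (forall om, f1 om = k) -> (forall om, f2 om = k) ->
  matched T f1 f2.
Proof.
move=> h1 h2; exists k, (fun=> 0), (fun=> 0).
by split=> om; rewrite ?h1 ?h2 /noise_comb !big1 ?addr0// => i _; rewrite !mul0mx mxE.
Qed.

Lemma matchedD T f1 f2 g1 g2 : matched T f1 f2 -> matched T g1 g2 ->
  matched T (fun om => f1 om + g1 om) (fun om => f2 om + g2 om).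
Proof.
move=> [k [b [c [f1E f2E]]]] [k' [b' [c' [g1E g2E]]]].
exists (k + k'), (fun i => b i + b' i), (fun i => c i + c' i).
have E l Om (F : 'M[R]_(r, l)) (w : nat -> Om -> 'cV[R]_l) (nu : nat -> Om -> 'cV[R]_p) om :
  noise_comb F w nu T k b c om + noise_comb F w nu T k' b' c' om =
  noise_comb F w nu T (k + k') (fun i => b i + b' i) (fun i => c i + c' i) om.
  rewrite /noise_comb addrACA; congr (_ + _); rewrite addrACA.
  by congr (_ + _); rewrite -big_split; apply: eq_bigr => i _ /=;
    rewrite !mulmxDl [RHS]mxE.
by split=> om; rewrite -E ?f1E ?f2E ?g1E ?g2E.
Qed.

Lemma matched_sum T (I : Type) (s : seq I) (f1 : I -> Om1 -> R) (f2 : I -> Om2 -> R) :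
  (forall i, matched T (f1 i) (f2 i)) ->
  matched T (fun om => \sum_(i <- s) f1 i om) (fun om => \sum_(i <- s) f2 i om).
Proof.
move=> h; elim: s => [|i s ih].
  by apply: (@matched_cst _ 0) => om; rewrite big_nil.
have [k [b [c [E1 E2]]]] := matchedD (h i) ih.
by exists k, b, c; split => om; rewrite big_cons ?E1 ?E2.
Qed.

Lemma matched_w T t (b : 'rV[R]_r) : (t < T)%N ->
  matched T (fun om => (b *m F1 *m w1 t om) ord0 ord0)
            (fun om => (b *m F2 *m w2 t om) ord0 ord0).
Proof.
move=> tT; exists 0, (fun i => if i == t then b else 0), (fun=> 0).
have E l Om (F : 'M[R]_(r, l)) (w : nat -> Om -> 'cV[R]_l) (nu : nat -> Om -> 'cV[R]_p) om :
  noise_comb F w nu T 0 (fun i => if i == t then b else 0) (fun=> 0) om =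
  (b *m F *m w t om) ord0 ord0.
  rewrite /noise_comb add0r [X in _ + X]big1 ?addr0; last first.
    by move=> i _; rewrite mul0mx mxE.
  rewrite (bigD1 (Ordinal tT))//= eqxx big1 ?addr0// => i it.
  case: eqP => [it'|_]; last by rewrite !mul0mx mxE.
  by case/eqP: it; apply: val_inj.
by split=> om; rewrite E.
Qed.

Lemma matched_nu T t (c : 'rV[R]_p) : (t < T)%N ->
  matched T (fun om => (c *m nu1 t om) ord0 ord0) (fun om => (c *m nu2 t om) ord0 ord0).
Proof.
move=> tT; exists 0, (fun=> 0), (fun i => if i == t then c else 0).
have E l Om (F : 'M[R]_(r, l)) (w : nat -> Om -> 'cV[R]_l) (nu : nat -> Om -> 'cV[R]_p) om :
  noise_comb F w nu T 0 (fun=> 0) (fun i => if i == t then c else 0) om =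
  (c *m nu t om) ord0 ord0.
  rewrite /noise_comb add0r big1 ?add0r; last by move=> i _; rewrite !mul0mx mxE.
  rewrite (bigD1 (Ordinal tT))//= eqxx big1 ?addr0// => i it.
  case: eqP => [it'|_]; last by rewrite mul0mx mxE.
  by case/eqP: it; apply: val_inj.
by split=> om; rewrite E.
Qed.

(** Mean and variance of such a combination involve the system only through [F mu] and [F F^T]. *)
Lemma matched_law T f1 f2 : noise_model P1 mu1 Psi w1 nu1 ->
  noise_model P2 mu2 Psi w2 nu2 -> F1 *m mu1 = F2 *m mu2 ->
  F1 *m F1^T = F2 *m F2^T -> matched T f1 f2 ->
  forall B, measurable B -> P1 [set om | B (f1 om)] = P2 [set om | B (f2 om)].
Proof.
move=> H1 H2 hmu hcov [k [b [c [f1E f2E]]]] B mB.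
under eq_set do rewrite f1E /noise_comb.
under [in RHS]eq_set do rewrite f2E /noise_comb.
apply: (etrans (noise_law_affine H1 T k (fun i => b i *m F1) c mB)).
apply/esym/(etrans (noise_law_affine H2 T k (fun i => b i *m F2) c mB)).
have -> : \sum_(i < T) (b i *m F2 *m mu2) ord0 ord0 =
          \sum_(i < T) (b i *m F1 *m mu1) ord0 ord0.
  by apply: eq_bigr => i _; rewrite -!mulmxA hmu.
have -> : \sum_(i < T) (b i *m F2 *m (b i *m F2)^T) ord0 ord0 =
          \sum_(i < T) (b i *m F1 *m (b i *m F1)^T) ord0 ord0.
  apply: eq_bigr => i _; rewrite !trmx_mul -(mulmxA (b i)) -(mulmxA (b i) F1).
  by rewrite (mulmxA F2) (mulmxA F1) hcov.
by [].
Qed.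

End matched.

Section one_system.
Context {R : realType} {d : measure_display} {Om : measurableType d}.
Context {P : probability Om R} {n m l p : nat}.
Variables (A : 'M[R]_n) (B : 'M[R]_(n, m)) (G : 'M[R]_(n, l)) (C : 'M[R]_(p, n)).
Context {mu : 'cV[R]_l} {Psi : 'M[R]_p}.
Context {w : nat -> Om -> 'cV[R]_l} {nu : nat -> Om -> 'cV[R]_p}.
Variables (x0 : 'cV[R]_n) (u : nat -> 'cV[R]_m).
Hypothesis H : noise_model P mu Psi w nu.

Lemma random_output t : random_mx (output_proc A B G C w nu x0 u t).
Proof.
apply: random_mxD; last exact: (noise_random_nu H).
by apply: random_mx_mulmx; exact: (random_state A B G x0 u H).
Qed.

Lemma law_first_state (b : 'rV[R]_n) (S : set R) : measurable S ->
  P [set om | S ((b *m state_proc A B G w 0 u 1 om) ord0 ord0)] =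
  gauss_law ((b *m (B *m u 0%N + G *m mu)) ord0 ord0)
    ((b *m G *m (b *m G)^T) ord0 ord0) S.
Proof.
move=> mS.
have E om : (b *m state_proc A B G w 0 u 1 om) ord0 ord0 = (b *m (B *m u 0%N)) ord0 ord0 +
    (\sum_(i < 1) (b *m G *m w i om) ord0 ord0 +
     \sum_(i < 1) ((0 : 'rV[R]_p) *m nu i om) ord0 ord0).
  rewrite state_procS state_proc0 mulmx0 add0r !big_ord1 mul0mx [X in _ + (_ + X)]mxE addr0.
  by rewrite mulmxDr mxE !mulmxA.
under eq_set do rewrite E.
apply: (etrans (noise_law_affine H 1 _ (fun=> b *m G) (fun=> 0) mS)).
rewrite !big_ord1 !mul0mx; congr (gauss_law _ _ S).
  by rewrite mulmxDr [RHS]mxE !mulmxA.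
by rewrite [X in _ + X]mxE addr0.
Qed.

(** At time 0 the state is deterministic, so the mean of the output reveals [C x0]; this is how (h4)
    is read off. *)
Lemma law_first_output (b : 'rV[R]_p) (S : set R) : measurable S ->
  P [set om | S ((b *m output_proc A B G C w nu x0 u 0 om) ord0 ord0)] =
  gauss_law ((b *m (C *m x0)) ord0 ord0) ((b *m Psi *m b^T) ord0 ord0) S.
Proof.
move=> mS.
have E om : (b *m output_proc A B G C w nu x0 u 0 om) ord0 ord0 =
    (b *m (C *m x0)) ord0 ord0 + (\sum_(i < 1) ((0 : 'rV[R]_l) *m w i om) ord0 ord0 +
     \sum_(i < 1) (b *m nu i om) ord0 ord0).
  rewrite /output_proc state_proc0 !big_ord1 mul0mx [X in _ + (X + _)]mxE add0r.
  by rewrite mulmxDr mxE.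
under eq_set do rewrite E.
apply: (etrans (noise_law_affine H 1 _ (fun=> 0) (fun=> b) mS)).
rewrite !big_ord1 !mul0mx; congr (gauss_law _ _ S).
  by rewrite [X in _ + X]mxE addr0.
by rewrite [X in X + _]mxE add0r.
Qed.

End one_system.

Section bisimulation.
Context {R : realType} {d1 d2 : measure_display}.
Context {Om1 : measurableType d1} {Om2 : measurableType d2}.
Variables (P1 : probability Om1 R) (P2 : probability Om2 R).
Variables (n1 n2 m l1 l2 p r : nat).
Variables (A1 : 'M[R]_n1) (B1 : 'M[R]_(n1, m)) (G1 : 'M[R]_(n1, l1)) (C1 : 'M[R]_(p, n1)).
Variables (A2 : 'M[R]_n2) (B2 : 'M[R]_(n2, m)) (G2 : 'M[R]_(n2, l2)) (C2 : 'M[R]_(p, n2)).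
Variables (mu1 : 'cV[R]_l1) (mu2 : 'cV[R]_l2) (Psi : 'M[R]_p).
Variables (w1 : nat -> Om1 -> 'cV[R]_l1) (nu1 : nat -> Om1 -> 'cV[R]_p).
Variables (w2 : nat -> Om2 -> 'cV[R]_l2) (nu2 : nat -> Om2 -> 'cV[R]_p).
Variables (R1 : 'M[R]_(r, n1)) (R2 : 'M[R]_(r, n2)).
Hypotheses (H1 : noise_model P1 mu1 Psi w1 nu1) (H2 : noise_model P2 mu2 Psi w2 nu2).
Hypothesis tot1 : forall x2 : 'cV[R]_n2, exists x1, R1 *m x1 = R2 *m x2.
Hypothesis inv : forall (x1 : 'cV[R]_n1) (x2 : 'cV[R]_n2), R1 *m x1 = R2 *m x2 -> R1 *m (A1 *m x1) = R2 *m (A2 *m x2).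

(** A vector in the kernel of [R1] is related to 0, so invariance keeps it in that kernel and
    [R1 A1] factors through [R1]. Totality carries the same factor over to the second system. *)
Lemma common_dynamics : exists Ab, R1 *m A1 = Ab *m R1 /\ R2 *m A2 = Ab *m R2.
Proof.
have [Ab AbE] : exists Ab, R1 *m A1 = Ab *m R1.
  by apply: mulmx_factor => x Rx; rewrite -mulmxA (@inv x 0) ?mulmx0// Rx.
exists Ab; split => //; apply: colV_inj => x2; have [x1 x12] := tot1 x2.
by rewrite -mulmxA -(inv x12) mulmxA AbE -!mulmxA x12.
Qed.

Lemma common_output : (forall (x1 : 'cV[R]_n1) (x2 : 'cV[R]_n2),
    R1 *m x1 = R2 *m x2 -> C1 *m x1 = C2 *m x2) ->
  exists Cb, C1 = Cb *m R1 /\ C2 = Cb *m R2.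
Proof.
move=> h4; have [Cb CbE] : exists Cb, C1 = Cb *m R1.
  by apply: mulmx_factor => x Rx; rewrite (@h4 x 0) ?mulmx0// Rx.
exists Cb; split => //; apply: colV_inj => x2; have [x1 x12] := tot1 x2.
by rewrite -(h4 x1)// CbE -!mulmxA x12.
Qed.

Local Notation matched := (@matched _ _ _ Om1 Om2 _ _ p r (R1 *m G1) (R2 *m G2) w1 nu1 w2 nu2).

Lemma matched_state (x10 : 'cV[R]_n1) (x20 : 'cV[R]_n2) u : R1 *m B1 = R2 *m B2 ->
  R1 *m x10 = R2 *m x20 ->
  forall T t (b : 'rV[R]_r), (t <= T)%N ->
  matched T (fun om => (b *m (R1 *m state_proc A1 B1 G1 w1 x10 u t om)) ord0 ord0)
            (fun om => (b *m (R2 *m state_proc A2 B2 G2 w2 x20 u t om)) ord0 ord0).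
Proof.
move=> h1 x12 T; have [Ab [Ab1 Ab2]] := common_dynamics.
have step n l (b : 'rV[R]_r) (Rn : 'M[R]_(r, n)) (A : 'M[R]_n) (B : 'M[R]_(n, m))
    (G : 'M[R]_(n, l)) (y : 'cV[R]_n) (a : 'cV[R]_m) (z : 'cV[R]_l) : Rn *m A = Ab *m Rn ->
    (b *m (Rn *m (A *m y + (B *m a + G *m z)))) ord0 ord0 =
    (b *m Ab *m (Rn *m y)) ord0 ord0 + (b *m (Rn *m B *m a)) ord0 ord0 +
    (b *m (Rn *m G) *m z) ord0 ord0 :> R.
  move=> RA; rewrite !mulmxDr mxE [X in _ + X]mxE addrA (mulmxA Rn A) RA.
  by rewrite !mulmxA.
elim=> [|t ih] b tT.
  by apply: (@matched_cst _ _ _ _ _ _ _ _ _ _ _ _ _ _ _ _ ((b *m (R1 *m x10)) ord0 ord0)) => om;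
    rewrite state_proc0 ?x12.
(* A functional [b] at time [t + 1] acts as [b Ab] at time [t], which is why the induction leaves
   [b] arbitrary. *)
have Dm := matchedD (matchedD (ih (b *m Ab) (ltnW tT))
  (@matched_cst _ _ _ Om1 Om2 _ _ p r (R1 *m G1) (R2 *m G2) w1 nu1 w2 nu2 T
     ((b *m (R1 *m B1 *m u t)) ord0 ord0) (fun=> _) (fun=> _) (fun=> erefl) (fun=> erefl)))
  (@matched_w _ _ _ Om1 Om2 _ _ p r (R1 *m G1) (R2 *m G2) w1 nu1 w2 nu2 T t b tT).
have [k [b' [c [E1 E2]]]] := Dm; exists k, b', c; split=> om.
  by rewrite -E1 state_procS (step _ _ _ _ _ _ _ _ _ _ Ab1).
by rewrite -E2 state_procS (step _ _ _ _ _ _ _ _ _ _ Ab2) h1.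
Qed.

Lemma law_state (x10 : 'cV[R]_n1) (x20 : 'cV[R]_n2) u t : R1 *m B1 = R2 *m B2 ->
  R1 *m G1 *m mu1 = R2 *m G2 *m mu2 ->
  R1 *m G1 *m G1^T *m R1^T = R2 *m G2 *m G2^T *m R2^T ->
  R1 *m x10 = R2 *m x20 -> forall S, Borel S ->
  P1 [set om | S (R1 *m state_proc A1 B1 G1 w1 x10 u t om)] =
  P2 [set om | S (R2 *m state_proc A2 B2 G2 w2 x20 u t om)].
Proof.
move=> h1 h2 h3 x12.
apply: (@cramer_wold _ _ _ _ _ _ _ P1 P2
  (fun om => R1 *m state_proc A1 B1 G1 w1 x10 u t om)
  (fun om => R2 *m state_proc A2 B2 G2 w2 x20 u t om)).
- by apply: random_mx_mulmx; exact: (random_state A1 B1 G1 x10 u H1).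
- by apply: random_mx_mulmx; exact: (random_state A2 B2 G2 x20 u H2).
move=> a B mB.
under eq_set do rewrite mxlin_col.
under [in RHS]eq_set do rewrite mxlin_col.
apply: (matched_law H1 H2 h2 _ (matched_state u h1 x12 a^T (leqnn t)) mB).
by rewrite !trmx_mul !mulmxA.
Qed.

Lemma law_output (x10 : 'cV[R]_n1) (x20 : 'cV[R]_n2) u : R1 *m B1 = R2 *m B2 ->
  R1 *m G1 *m mu1 = R2 *m G2 *m mu2 ->
  R1 *m G1 *m G1^T *m R1^T = R2 *m G2 *m G2^T *m R2^T ->
  (forall (x1 : 'cV[R]_n1) (x2 : 'cV[R]_n2),
    R1 *m x1 = R2 *m x2 -> C1 *m x1 = C2 *m x2) ->
  R1 *m x10 = R2 *m x20 ->
  stoch_equiv P1 P2 (output_proc A1 B1 G1 C1 w1 nu1 x10 u)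
                    (output_proc A2 B2 G2 C2 w2 nu2 x20 u).
Proof.
move=> h1 h2 h3 h4 x12 k ts; have [Cb [Cb1 Cb2]] := common_output h4.
have rj d (Om : measurableType d) (y : nat -> Om -> 'cV[R]_p) :
    (forall t, random_mx (y t)) -> random_mx (joint y ts).
  move=> ry; apply/random_mxP => i j; under eq_fun do rewrite mxE.
  by have /random_mxP := ry (ts j); exact.
apply: cramer_wold.
- by apply: rj => t; exact: (random_output A1 B1 G1 C1 x10 u H1).
- by apply: rj => t; exact: (random_output A2 B2 G2 C2 x20 u H2).
move=> a B mB.
have jE Om (y : nat -> Om -> 'cV[R]_p) om : mxlin a (joint y ts om) =
    \sum_(j < k) ((col j a)^T *m y (ts j) om) ord0 ord0.
  rewrite /mxlin exchange_big; apply: eq_bigr => j _; rewrite mxE.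
  by apply: eq_bigr => i _; rewrite !mxE.
under eq_set do rewrite jE.
under [in RHS]eq_set do rewrite jE.
(* A horizon beyond all sampling times; since [matched] is stable under sums, the times may repeat
   and come in any order. *)
pose T := (\max_(j < k) ts j).+1.
apply: (@matched_law _ _ _ _ _ _ _ _ _ P1 P2 (R1 *m G1) (R2 *m G2) mu1 mu2 Psi
  w1 nu1 w2 nu2 T _ _ H1 H2 h2 _ _ B mB).
  by rewrite !trmx_mul !mulmxA.
apply: matched_sum => j.
have tT : (ts j < T)%N by rewrite ltnS; exact: (@leq_bigmax _ ts j).
have [k' [b [c [E1 E2]]]] := matchedD
  (matched_state u h1 x12 ((col j a)^T *m Cb) (ltnW tT))
  (@matched_nu _ _ _ Om1 Om2 _ _ p r (R1 *m G1) (R2 *m G2) w1 nu1 w2 nu2 T _ (col j a)^T tT).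
exists k', b, c; split => om.
  by rewrite -E1 /output_proc mulmxDr mxE Cb1 !mulmxA.
by rewrite -E2 /output_proc mulmxDr mxE Cb2 !mulmxA.
Qed.

End bisimulation.

(** * Reformulation of bisimulation and necessity of the conditions *)

Section characterization.
Context {R : realType} {d1 d2 : measure_display}.
Context {Om1 : measurableType d1} {Om2 : measurableType d2}.
Variables (P1 : probability Om1 R) (P2 : probability Om2 R).
Variables (n1 n2 m l1 l2 p r : nat).
Variables (A1 : 'M[R]_n1) (B1 : 'M[R]_(n1, m)) (G1 : 'M[R]_(n1, l1)) (C1 : 'M[R]_(p, n1)).
Variables (A2 : 'M[R]_n2) (B2 : 'M[R]_(n2, m)) (G2 : 'M[R]_(n2, l2)) (C2 : 'M[R]_(p, n2)).
Variables (mu1 : 'cV[R]_l1) (mu2 : 'cV[R]_l2) (Psi : 'M[R]_p).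
Variables (w1 : nat -> Om1 -> 'cV[R]_l1) (nu1 : nat -> Om1 -> 'cV[R]_p).
Variables (w2 : nat -> Om2 -> 'cV[R]_l2) (nu2 : nat -> Om2 -> 'cV[R]_p).
Variables (R1 : 'M[R]_(r, n1)) (R2 : 'M[R]_(r, n2)).
Hypotheses (H1 : noise_model P1 mu1 Psi w1 nu1) (H2 : noise_model P2 mu2 Psi w2 nu2).
Hypothesis tot : rel_total (ker_pair R1 R2).

Local Notation x1 := (state_proc A1 B1 G1 w1).
Local Notation x2 := (state_proc A2 B2 G2 w2).
Local Notation y1 := (output_proc A1 B1 G1 C1 w1 nu1).
Local Notation y2 := (output_proc A2 B2 G2 C2 w2 nu2).

(** Totality makes every set admissible in (i) and (ii), and membership in the relation is equality
    of the projections. *)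
Lemma stoch_bisimP :
  stoch_bisim P1 P2 A1 B1 G1 C1 w1 nu1 A2 B2 G2 C2 w2 nu2 (ker_pair R1 R2) <->
  forall x10 x20 u t, R1 *m x10 = R2 *m x20 ->
    [/\ transfer_cond P1 P2 A1 B1 G1 w1 R1 x10 u t (fun om => R2 *m x2 x20 u t om),
        transfer_cond P2 P1 A2 B2 G2 w2 R2 x20 u t (fun om => R1 *m x1 x10 u t om) &
        stoch_equiv P1 P2 (y1 x10 u) (y2 x20 u)].
Proof.
have [img pre] := tot.
have E1 X x20 u t : [set om | rel_img (ker_pair R1 R2) X (x2 x20 u t om)] =
    [set om | exists2 y, X y & R1 *m y = R2 *m x2 x20 u t om].
  apply/seteqP; split => om /= [y Xy h]; exists y => //.
    exact/ker_pairP.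
  exact/ker_pairP.
have E2 X x10 u t : [set om | rel_pre (ker_pair R1 R2) X (x1 x10 u t om)] =
    [set om | exists2 y, X y & R2 *m y = R1 *m x1 x10 u t om].
  apply/seteqP; split => om /= [y Xy h]; exists y => //.
    by apply/esym/ker_pairP.
  by apply/ker_pairP.
split=> h x10 x20 u t /ker_pairP x12; have [h1 h2 h3] := h x10 x20 u t x12.
- split => // X bX.
  + by rewrite h1 ?E1// pre; exact: subsetT.
  + by rewrite h2 ?E2// img; exact: subsetT.
- split => // X bX _.
  + by rewrite E1 h1.
  + by rewrite E2 h2.
Qed.

Lemma bisim_necessary :
  stoch_bisim P1 P2 A1 B1 G1 C1 w1 nu1 A2 B2 G2 C2 w2 nu2 (ker_pair R1 R2) ->
  [/\ R1 *m B1 = R2 *m B2,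
       R1 *m G1 *m mu1 = R2 *m G2 *m mu2,
       R1 *m G1 *m G1^T *m R1^T = R2 *m G2 *m G2^T *m R2^T,
       ker_pair R1 R2 `<=` ker_pair C1 C2 &
       (forall v : 'cV[R]_n1, (exists z, v = Reach A1 G1 *m z) ->
          R1 *m v = 0 -> v = 0) /\
       (forall v : 'cV[R]_n2, (exists z, v = Reach A2 G2 *m z) ->
          R2 *m v = 0 -> v = 0)].
Proof.
move=> /stoch_bisimP bis.
have x00 : R1 *m 0 = R2 *m (0 : 'cV[R]_n2) by rewrite !mulmx0.
(* One step from the origin under the constant input [a]. Taking [a = 0] gives (h2), and subtracting
   it from the general mean gives (h1). *)
have step (a : 'cV[R]_m) (b : 'rV[R]_r) :
    (b *m (R1 *m (B1 *m a + G1 *m mu1))) ord0 ord0 =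
    (b *m (R2 *m (B2 *m a + G2 *m mu2))) ord0 ord0 /\
    (b *m R1 *m G1 *m (b *m R1 *m G1)^T) ord0 ord0 =
    (b *m R2 *m G2 *m (b *m R2 *m G2)^T) ord0 ord0.
  rewrite !(mulmxA b).
  apply: gauss_law_inj; [exact: mulmx_tr_ge0|exact: mulmx_tr_ge0|] => B mB.
  rewrite -(law_first_state A1 B1 G1 (fun=> a) H1 (b *m R1) mB).
  rewrite -(law_first_state A2 B2 G2 (fun=> a) H2 (b *m R2) mB).
  have [tc _ _] := bis 0 0 (fun=> a) 1%N x00.
  have rY : random_mx (fun om => R2 *m x2 0 (fun=> a) 1%N om).
    by apply: random_mx_mulmx; exact: (random_state A2 B2 G2 0 (fun=> a) H2).
  under eq_set do rewrite -mulmxA.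
  under [in RHS]eq_set do rewrite -mulmxA.
  exact: (law_transfer H1 rY tc (Borel_linear_form b mB)).
have mean a : R1 *m (B1 *m a + G1 *m mu1) = R2 *m (B2 *m a + G2 *m mu2).
  by apply: rowV_inj => b; case: (step a b).
have h2 : R1 *m G1 *m mu1 = R2 *m G2 *m mu2.
  by have := mean 0; rewrite !mulmx0 !add0r !mulmxA.
split=> //.
- apply: colV_inj => a; have := mean a.
  rewrite !mulmxDr !mulmxA h2; exact: addIr.
- apply: quad_form_inj.
  + by rewrite !trmx_mul !trmxK !mulmxA.
  + by rewrite !trmx_mul !trmxK !mulmxA.
  + by move=> b; have [_] := step 0 b; rewrite !trmx_mul !mulmxA.
- move=> [x10 x20] /ker_pairP x12; apply/ker_pairP; apply: rowV_inj => b.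
  suff [] : (b *m (C1 *m x10)) ord0 ord0 = (b *m (C2 *m x20)) ord0 ord0 /\
      (b *m Psi *m b^T) ord0 ord0 = (b *m Psi *m b^T) ord0 ord0 by [].
  apply: gauss_law_inj; [exact: (noise_cov_ge0 H1)|exact: (noise_cov_ge0 H1)|] => B mB.
  rewrite -(law_first_output A1 B1 G1 C1 x10 (fun=> 0) H1 b mB).
  rewrite -(law_first_output A2 B2 G2 C2 x20 (fun=> 0) H2 b mB).
  have [_ _ se] := bis x10 x20 (fun=> 0) 0%N x12.
  have jE Om (y : nat -> Om -> 'cV[R]_p) om : joint y (fun _ : 'I_1 => 0%N) om = y 0%N om.
    by apply/matrixP => i j; rewrite mxE (ord1 j).
  under eq_set do rewrite -jE.
  under [in RHS]eq_set do rewrite -jE.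
  exact: (se 1%N (fun=> 0%N) _ (Borel_linear_form b mB)).
- split.
  (* At time [n1] the matrix [reach_aux] is [Reach] itself. *)
  + have [tc _ _] := bis 0 0 (fun=> 0) n1 x00.
    by apply: (transfer_reach_inj H1 tc).
  + have [_ tc _] := bis 0 0 (fun=> 0) n2 x00.
    by apply: (transfer_reach_inj H2 tc).
Qed.

End characterization.

Unset Implicit Arguments.

Theorem theorem2 (R : realType) (d1 d2 : measure_display)
  (Om1 : measurableType d1) (Om2 : measurableType d2)
  (P1 : probability Om1 R) (P2 : probability Om2 R)
  (n1 n2 m l1 l2 p r : nat)
  (A1 : 'M[R]_n1) (B1 : 'M[R]_(n1, m)) (G1 : 'M[R]_(n1, l1)) (C1 : 'M[R]_(p, n1))
  (mu1 : 'cV[R]_l1) (Psi1 : 'M[R]_p)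
  (w1 : nat -> Om1 -> 'cV[R]_l1) (nu1 : nat -> Om1 -> 'cV[R]_p)
  (A2 : 'M[R]_n2) (B2 : 'M[R]_(n2, m)) (G2 : 'M[R]_(n2, l2)) (C2 : 'M[R]_(p, n2))
  (mu2 : 'cV[R]_l2) (Psi2 : 'M[R]_p)
  (w2 : nat -> Om2 -> 'cV[R]_l2) (nu2 : nat -> Om2 -> 'cV[R]_p)
  (R1 : 'M[R]_(r, n1)) (R2 : 'M[R]_(r, n2)) :
  noise_model P1 mu1 Psi1 w1 nu1 ->
  noise_model P2 mu2 Psi2 w2 nu2 ->
  Psi1 = Psi2 ->
  rel_total (ker_pair R1 R2) ->
  (forall x : 'cV[R]_n1 * 'cV[R]_n2, ker_pair R1 R2 x ->
     ker_pair R1 R2 (A1 *m x.1, A2 *m x.2)) ->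
  (stoch_bisim P1 P2 A1 B1 G1 C1 w1 nu1 A2 B2 G2 C2 w2 nu2 (ker_pair R1 R2) <->
   [/\ R1 *m B1 = R2 *m B2,
       R1 *m G1 *m mu1 = R2 *m G2 *m mu2,
       R1 *m G1 *m G1^T *m R1^T = R2 *m G2 *m G2^T *m R2^T,
       ker_pair R1 R2 `<=` ker_pair C1 C2 &
       (forall v : 'cV[R]_n1, (exists z, v = Reach A1 G1 *m z) ->
          R1 *m v = 0 -> v = 0) /\
       (forall v : 'cV[R]_n2, (exists z, v = Reach A2 G2 *m z) ->
          R2 *m v = 0 -> v = 0)]).
Proof.
move=> H1 H2 Psi12; move: H1; rewrite Psi12 => H1 tot inv.
split=> [|[h1 h2 h3 h4 [h51 h52]]]; first exact: (bisim_necessary H1 H2 tot).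
have tot1 (x2 : 'cV[R]_n2) : exists x1, R1 *m x1 = R2 *m x2.
  have [/seteqP[_ /(_ x2 I) [x1 _ /ker_pairP x12]] _] := tot.
  by exists x1.
have inv' (x1 : 'cV[R]_n1) (x2 : 'cV[R]_n2) :
    R1 *m x1 = R2 *m x2 -> R1 *m (A1 *m x1) = R2 *m (A2 *m x2).
  by move=> /ker_pairP /inv /ker_pairP.
have h4' (x1 : 'cV[R]_n1) (x2 : 'cV[R]_n2) :
    R1 *m x1 = R2 *m x2 -> C1 *m x1 = C2 *m x2.
  by move=> /ker_pairP /h4 /ker_pairP.
apply/(stoch_bisimP _ _ _ _ _ _ _ _ _ _ _ _ _ _ tot) => x10 x20 u t x12.
have law := law_state H1 H2 tot1 inv' u t h1 h2 h3 x12.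
split.
- exact: (transfer_law H1).
- by apply: (transfer_law H2) => // S bS; rewrite law.
- exact: (law_output H1 H2 tot1 inv').
Qed.
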